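(* Let $\hat N$ be a point basis of a projective geometry $\mathbb{P}$ and $\mathcal{A}$ any set of apical hyperplanes of $\hat N$ (a Cevian arrangement). Then $\Omega(\mathcal{A})$ is a biased graph, and the correspondence $e\mapsto\mathbf{h}(e)$ is an isomorphism $G(\Omega(\mathcal{A}))\cong M(\mathcal{A})$. The intersection flats of $\mathcal{A}$ correspond bijectively to the closed sets of $G(\Omega(\mathcal{A}))$ via $t\mapsto\mathbf{H}(t):=\{e:\mathbf{h}(e)\supseteq t\}$. A connected nonempty edge set $S$ of $\Omega(\mathcal{A})$ is unbalanced if and only if $\bigcap_{e\in S}\mathbf{h}(e)$ is an intersection of node hyperplanes $\hat v^*$.
   Context: $\hat N=\{\hat v:v\in N\}$ is a basis of $\mathbb{P}$ (an axiomatic finitary projective geometry). For $p$ on a line $\hat v\hat w$ ($v\ne w$): the apical hyperplane is $h(p)=\mathrm{Span}((\hat N\setminus\{\hat v,\hat w\})\cup\{p\})$ if $p\notin\hat N$, and $h(p)=\hat p^*=\mathrm{Span}(\hat N\setminus\{p\})$ (a node hyperplane) if $p\in\hat N$. The graph $\Gamma$ of $\mathcal{A}$ has node set $N$ and one edge per member of $\mathcal{A}$: $\hat v^*$ gives a half edge at $v$, $h(p)$ with $p\in\hat v\hat w\setminus\hat N$ gives a link $e_{vw}$; $\mathbf{h}(e)$ is the hyperplane of $e$. For finite $S\subseteq E$, $\mathrm{rk}_{\mathbb{P}}(S)=\operatorname{codim}\bigcap_{e\in S}\mathbf{h}(e)$. $\Omega(\mathcal{A})=(\Gamma,\mathcal{B})$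 where $\mathcal{B}$ is the set of circles $C$ (edge sets of connected 2-regular subgraphs) with $\mathrm{rk}_{\mathbb{P}}C<\#C$. $M(\mathcal{A})$ is the matroid on $\mathcal{A}$ with rank function $\mathcal{S}\mapsto\operatorname{codim}\bigcap\mathcal{S}$ (finite $\mathcal{S}$). A biased graph requires no theta subgraph (three internally disjoint paths with common endpoints) to contain exactly two balanced circles; an edge set is balanced if it has no half edge and all its circles are balanced. The frame matroid $G(\Omega)$ has rank function on finite $S$: $\#N(S)-b(S)$ where $b(S)$ is the number of balanced components of $(N(S),S)$.
   Formalization: As the last two claims fail in infinite rank (the ray x_i = x_{i+1}), flats that are finite intersections are matched with closed sets of finite rank (all flats with all closed sets if N is finite), and the unbalance criterion is stated for connected S with finitely many nodes. *)

(* Defs.v *)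
From mathcomp Require Import all_boot.
From mathcomp Require Import boolp classical_sets functions cardinality.
From Stdlib Require List.

Set Implicit Arguments.
Unset Strict Implicit.
Unset Printing Implicit Defensive.

Local Open Scope classical_set_scope.
Local Open Scope card_scope.

(* Cardinality of a finite set; 0 on infinite sets. *)
Definition ncard (T : Type) (X : set T) : nat := xget 0 [set n | X #= `I_n].

(** * Projective geometry *)

(* Points and lines with the Veblen-Young axioms; no restriction on the
   dimension, which may be infinite. *)
Record projGeom := ProjGeom {
  point :> Type;
  lines : set (set point);
  line_exists : forall p q : point, p <> q ->
    exists l, [/\ lines l, l p & l q];
  line_unique : forall (p q : point) (l m : set point), p <> q ->
    lines l -> lines m -> l p -> l q -> m p -> m q -> l = m;
  line_thick : forall l, lines l -> exists p q r : point,
    [/\ p <> q, p <> r & q <> r] /\ [/\ l p, l q & l r];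
  veblen : forall (a b c d : point) (ab cd ac bd : set point),
    List.NoDup [:: a; b; c; d] ->
    [/\ lines ab, lines cd, lines ac & lines bd] ->
    (ab a /\ ab b) -> (cd c /\ cd d) -> (ac a /\ ac c) -> (bd b /\ bd d) ->
    ab `&` cd !=set0 -> ac `&` bd !=set0 }.

Section Geometry.
Variable P : projGeom.
Implicit Types (X B W t : set P) (p q : P).

Definition collinear p q (r : P) := exists l : set P, [/\ lines l, l p, l q & l r].

Definition subspace W := forall p q l, p <> q -> W p -> W q ->
  lines l -> l p -> l q -> l `<=` W.

Definition Span X : set P := smallest subspace X.

Definition independent X := forall p, X p -> ~ Span (X `\ p) p.

Definition point_basis B := independent B /\ Span B = setT.

(* codim t is the least number of points that span P together with t; the
   value is 0 if no finite set of points does. *)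
Definition codim t : nat :=
  let spans n := exists X, X #= `I_n /\ Span (t `|` X) = setT in
  xget 0 [set n | spans n /\ forall m, spans m -> (n <= m)%N].

End Geometry.

(** * Matroids of possibly infinite rank, given by the rank of finite sets *)

Record rankSystem (T : Type) := RankSystem {
  ground : set T;
  rank : set T -> nat }.

Definition matroid (T : Type) (M : rankSystem T) :=
  forall S U : set T, finite_set S -> finite_set U ->
    S `<=` ground M -> U `<=` ground M ->
  [/\ (rank M S <= ncard S)%N,
      S `<=` U -> (rank M S <= rank M U)%N
    & (rank M (S `|` U) + rank M (S `&` U) <= rank M S + rank M U)%N].

Definition matroid_iso (T U : Type) (f : T -> U)
    (M : rankSystem T) (M' : rankSystem U) :=
  [/\ matroid M, matroid M', set_bij (ground M) (ground M') f
    & forall S, finite_set S -> S `<=` ground M ->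
        rank M' (f @` S) = rank M S].

Section Matroid.
Variables (T : Type) (M : rankSystem T).

Definition closure (S : set T) : set T :=
  [set e | ground M e /\ exists F,
     [/\ finite_set F, F `<=` S & rank M (e |` F) = rank M F]].

Definition closed_set (S : set T) := S `<=` ground M /\ closure S = S.

Definition finite_rank (S : set T) :=
  exists n, forall F, finite_set F -> F `<=` S -> (rank M F <= n)%N.

End Matroid.

(** * Graphs with links and half edges *)

(* [half e v]: e is a half edge at v; [link e v w]: e is a link with ends v
   and w. [is_graph] says that every edge is of exactly one kind and has
   well-determined ends. *)
Record graph (N E : Type) := Graph {
  half : E -> N -> Prop;
  link : E -> N -> N -> Prop }.

Section Graph.
Variables (N E : Type) (G : graph N E).
Implicit Types (S C : set E) (v w : N) (e : E).

Definition is_graph := forall e,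
  (exists v, (forall x, half G e x <-> x = v) /\ forall x y, ~ link G e x y)
  \/
  (exists v w, [/\ v <> w, forall x, ~ half G e x
    & forall x y, link G e x y <-> (x = v /\ y = w) \/ (x = w /\ y = v)]).

Definition incident e v := half G e v \/ exists w, link G e v w.

Definition nodes_of S : set N := [set v | exists2 e, S e & incident e v].

Fixpoint walk v (p : seq (E * N)) w : Prop :=
  if p is (e, u) :: q then link G e v u /\ walk u q w else v = w.

Definition walk_edges (p : seq (E * N)) : set E :=
  [set e | List.In e (map fst p)].

Definition walk_nodes v (p : seq (E * N)) : seq N := v :: map snd p.

Definition is_path v p w := walk v p w /\ List.NoDup (walk_nodes v p).

Definition joined S v w := exists2 p, walk v p w & walk_edges p `<=` S.

Definition connected S := forall v w,
  nodes_of S v -> nodes_of S w -> joined S v w.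

(* Edge sets of finite connected 2-regular subgraphs; these contain no half
   edges. *)
Definition circle C :=
  [/\ finite_set C, C !=set0, forall e v, C e -> ~ half G e v, connected C
    & forall v, nodes_of C v -> [set e | C e /\ incident e v] #= `I_2].

(* Internally disjoint paths must also be edge-disjoint, as otherwise the same
   single link could be used twice. *)
Definition internally_disjoint v w (p q : seq (E * N)) :=
  walk_edges p `&` walk_edges q = set0 /\
  forall x, List.In x (walk_nodes v p) -> List.In x (walk_nodes v q) ->
    x = v \/ x = w.

Definition theta S := exists v w p q r,
  [/\ v <> w,
      [/\ is_path v p w, is_path v q w & is_path v r w],
      [/\ internally_disjoint v w p q, internally_disjoint v w p r
        & internally_disjoint v w q r]
    & S = walk_edges p `|` walk_edges q `|` walk_edges r].

(* The node sets of the components of (N(S), S). *)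
Definition component S (X : set N) :=
  exists2 v, nodes_of S v & X = [set w | joined S v w].

Definition edges_at S (X : set N) : set E :=
  [set e | S e /\ exists2 v, X v & incident e v].

End Graph.

(** * Biased graphs *)

Record biasedGraph (N E : Type) := BiasedGraph {
  bg_graph :> graph N E;
  balanced_circles : set (set E) }.

Section Biased.
Variables (N E : Type) (O : biasedGraph N E).

Definition is_biased_graph :=
  [/\ is_graph O, balanced_circles O `<=` circle O
    & forall S, theta O S ->
        ~ ([set C | balanced_circles O C /\ C `<=` S] #= `I_2)].

Definition balanced (S : set E) :=
  (forall e v, S e -> ~ half O e v) /\
  forall C, circle O C -> C `<=` S -> balanced_circles O C.

Definition num_balanced_components (S : set E) : nat :=
  ncard [set X | component O S X /\ balanced (edges_at O S X)].

(* The subtraction never truncates: components are nonempty and disjoint. *)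
Definition frame_matroid : rankSystem E :=
  RankSystem setT
    (fun S => ncard (nodes_of O S) - num_balanced_components S)%N.

End Biased.

(** * Cevian arrangements *)

Section Cevian.
Variables (P : projGeom) (N : Type) (hat : N -> P).

Definition node_hyperplane (v : N) : set P := Span (range hat `\ hat v).

Definition apical_hyperplane (v w : N) (p : P) : set P :=
  if `[< range hat p >] then Span (range hat `\ p)
  else Span ((range hat `\` [set hat v; hat w]) `|` [set p]).

Definition apical_hyperplanes : set (set P) :=
  [set H | exists v w p, [/\ v <> w, collinear (hat v) (hat w) p
                           & H = apical_hyperplane v w p]].

Variable A : set (set P).

(* The edges are the members of A. *)
Definition hyp (e : A) : set P := set_val e.

Definition cevian_graph : graph N A := Graph
  (fun e v => hyp e = node_hyperplane v)
  (fun e v w => v <> w /\ exists p,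
     [/\ collinear (hat v) (hat w) p, ~ range hat p
       & hyp e = apical_hyperplane v w p]).

Definition rkP (S : set A) : nat := codim (\bigcap_(e in S) hyp e).

Definition Omega : biasedGraph N A := BiasedGraph cevian_graph
  [set C | circle cevian_graph C /\ (rkP C < ncard C)%N].

Definition arrangement_matroid : rankSystem (set P) :=
  RankSystem A (fun S => codim (\bigcap_(H in S) H)).

Definition intersection_flats : set (set P) :=
  [set t | exists S : set A, t = \bigcap_(e in S) hyp e].

Definition finite_intersection_flats : set (set P) :=
  [set t | exists2 S : set A, finite_set S & t = \bigcap_(e in S) hyp e].

Definition edges_above (t : set P) : set A := [set e | t `<=` hyp e].

End Cevian.

(* Main.v *)
(** A hyperplane h(e) of the arrangement misses the basis point of v exactly
    when v is an end of e. Write Z X for the span of the basis points outside X,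
    so that the node hyperplane of v is Z {v}. If q lies in h(e) for a link e
    with ends v, w, then q lies in Z {v} iff it lies in Z {w}; hence for a
    connected edge set S with finite node set X the flat of S is either Z X or
    the join of Z X with a single point q lying in no Z {v}, v in X (a
    potential of S). So the codimension of the flat is #X or #X - 1, and since
    a circle has as many edges as nodes, it is balanced iff it has a potential.
    Potentials extend along a link to a new node and are determined modulo Z X,
    so growing a potential node by node and closing up circles shows that S is
    balanced iff it has a potential. Flats of distinct components jointly span
    the space, so by modularity codimension is additive over components, which
    gives the rank formula of the frame matroid. In a theta, modularity applied
    to two balanced circles gives a potential of the whole theta, so the third
    circle is balanced too. *)

Require Import Defs.
From mathcomp Require Import all_boot zify.
From mathcomp Require Import boolp classical_sets functions cardinality.
From Stdlib Require List.

Set Implicit Arguments.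
Unset Strict Implicit.
Unset Printing Implicit Defensive.

Local Open Scope classical_set_scope.
Local Open Scope card_scope.

(** * Finite cardinals *)

Section Cardinals.
Variable T : Type.
Implicit Types (X Y : set T) (x : T).

Lemma card_II_inj X m n : X #= `I_m -> X #= `I_n -> m = n.
Proof.
move=> Xm Xn; apply/card_eq_II; apply: card_eq_trans Xn.
by rewrite card_eq_sym.
Qed.

Lemma ncardE X n : X #= `I_n -> ncard X = n.
Proof. by move=> Xn; apply: xget_unique => // m /card_II_inj; apply. Qed.

Lemma card_ncard X : finite_set X -> X #= `I_(ncard X).
Proof. by case/finite_setP=> n Xn; rewrite (ncardE Xn). Qed.

Lemma card_IIU1 X x n : ~ X x -> X #= `I_n -> (x |` X) #= `I_n.+1.
Proof.
move=> nXx Xn; apply/eq_cardSP; exists x; first by left.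
by rewrite setUC setUDK // => z [-> /nXx].
Qed.

Lemma finite_set_induct (Q : set T -> Prop) : Q set0 ->
  (forall x X, finite_set X -> ~ X x -> Q X -> Q (x |` X)) ->
  forall X, finite_set X -> Q X.
Proof.
move=> Q0 QS X /finite_setP[n].
elim: n X => [|n IH] X; first by rewrite II0 card_eq0 => /eqP ->.
case/eq_cardSP=> x Xx Xn; rewrite -(setD1K Xx).
apply: QS; [by apply/finite_setP; exists n | by case=> _ /(_ erefl) | exact: IH].
Qed.

Lemma ncard0 : ncard (@set0 T) = 0.
Proof. by apply: ncardE; rewrite II0 card_eq0. Qed.

Lemma ncardU1 X x : finite_set X -> ~ X x -> ncard (x |` X) = (ncard X).+1.
Proof. by move=> Xf nXx; apply/ncardE/card_IIU1 => //; exact: card_ncard. Qed.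

Lemma ncard_gt0 X : finite_set X -> X !=set0 -> (0 < ncard X)%N.
Proof.
move=> Xf [x Xx]; rewrite -(setD1K Xx) ncardU1 //; last by case=> _ /(_ erefl).
exact: finite_setD.
Qed.

Lemma ncardU X Y : finite_set X -> finite_set Y -> X `&` Y = set0 ->
  ncard (X `|` Y) = ncard X + ncard Y.
Proof.
move=> Xf Yf; move: X Xf; apply: finite_set_induct.
  by rewrite set0U ncard0.
move=> x X Xf nXx IH XY0; rewrite -setUA ncardU1 ?ncardU1 ?IH //.
- by rewrite -subset0 -XY0 => z [Xz Yz]; split=> //; right.
- by rewrite finite_setU.
- by case=> // Yx; have : set0 x by rewrite -XY0; split=> //; left.
Qed.

Lemma ncard_setD X Y : finite_set X -> finite_set Y -> Y `<=` X ->
  ncard X = ncard Y + ncard (X `\` Y).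
Proof.
move=> Xf Yf YX; rewrite -ncardU ?setDUK //; first exact: finite_setD.
by rewrite -subset0 => z [Yz []].
Qed.

Lemma ncardUI X Y : finite_set X -> finite_set Y ->
  ncard (X `|` Y) + ncard (X `&` Y) = ncard X + ncard Y.
Proof.
move=> Xf Yf; have -> : X `|` Y = Y `|` (X `\` Y).
  by apply/seteqP; split=> z; have [] := pselect (Y z); rewrite /=; tauto.
rewrite ncardU //; last by rewrite -subset0 => z [Yz []].
- rewrite (@ncard_setD X (X `&` Y)) //; last exact: finite_setIl.
  by rewrite setDIr setDv set0U; lia.
- exact: finite_setD.
Qed.

Lemma subset_ncard X Y : finite_set Y -> X `<=` Y -> (ncard X <= ncard Y)%N.
Proof.
move=> Yf XY; rewrite (@ncard_setD Y X) ?leq_addr //.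
exact: sub_finite_set XY Yf.
Qed.

Lemma subset_ncard_eq X Y : finite_set Y -> X `<=` Y ->
  (ncard Y <= ncard X)%N -> X = Y.
Proof.
move=> Yf XY; have Xf := sub_finite_set XY Yf.
rewrite (ncard_setD Yf Xf XY) -[X in (_ <= X)%N]addn0 leq_add2l leqn0 => /eqP D0.
apply/seteqP; split=> // z Yz; apply: contrapT => nXz.
have : (0 < ncard (Y `\` X))%N by apply: ncard_gt0; [exact: finite_setD|exists z].
by rewrite D0.
Qed.

Lemma card_set2 x y : x <> y -> [set x; y] #= `I_2.
Proof. by move=> xy; apply: card_IIU1; rewrite ?card_set1 // => /esym. Qed.

End Cardinals.

Lemma ncard_image (T U : Type) (f : T -> U) (X : set T) : finite_set X -> injective f ->
  ncard (f @` X) = ncard X.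
Proof.
move=> Xf finj; apply: ncardE; apply: card_eq_trans (card_ncard Xf).
by apply: inj_card_eq => x y _ _; apply: finj.
Qed.

(** The pairs over a fixed [x] are an injective image of its fibre, so the pairs are counted fibre
    by fibre; [double_count] does this from both sides. *)
Lemma ncard_flags (T U : Type) (r : T -> U -> Prop) k (X : set T) :
  finite_set X -> (forall x, X x -> [set u | r x u] #= `I_k) ->
  [set z | X z.1 /\ r z.1 z.2] #= `I_(k * ncard X).
Proof.
move: X; apply: finite_set_induct => [_|x X Xf nXx IH rk].
  rewrite ncard0 muln0 II0 card_eq0; apply/eqP; rewrite -subset0.
  by move=> z [].
rewrite ncardU1 // mulnS.
set F := [set z | X z.1 /\ r z.1 z.2] in IH *.
set K := [set u | r x u].
have -> : [set z | (x |` X) z.1 /\ r z.1 z.2] = pair x @` K `|` F.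
  apply/seteqP; split=> -[y u] /=.
    by case=> -[->|Xy] ru; [left; exists u|right].
  by case=> [[u' ru' [<- <-]]|[Xy ru]]; split=> //; [left|right].
have Fk : F #= `I_(k * ncard X) by apply: IH => y Xy; apply: rk; right.
have Kk : K #= `I_k by apply: rk; left.
have pinj : injective (pair x : U -> T * U) by move=> u v [].
have Kf : finite_set K by apply/finite_setP; exists k.
have Ff : finite_set F by apply/finite_setP; eexists; exact: Fk.
rewrite -(ncardE Fk) -(ncardE Kk) -(ncard_image Kf pinj) -ncardU //; last 1 first.
- by rewrite -subset0 => _ [[u _ <-]] [].
- by apply: card_ncard; rewrite finite_setU; split=> //; exact: finite_image.
- exact: finite_image.
Qed.

(** Both sides count the related pairs, identified by swapping coordinates, and the positive factor
    [k] cancels. *)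
Lemma double_count (T U : Type) (r : T -> U -> Prop) k (X : set T) (Y : set U) :
  (0 < k)%N -> finite_set X -> finite_set Y ->
  (forall x, X x -> [set u | Y u /\ r x u] #= `I_k) ->
  (forall u, Y u -> [set x | X x /\ r x u] #= `I_k) -> ncard X = ncard Y.
Proof.
move=> k0 Xf Yf rX rY.
have /ncardE FX := ncard_flags Xf rX; have FY := ncard_flags Yf rY.
have sinj : injective (fun z : U * T => (z.2, z.1)) by move=> [a b] [c d] [-> ->].
have Ff : finite_set [set z | Y z.1 /\ X z.2 /\ r z.2 z.1].
  by apply/finite_setP; eexists; exact: FY.
have := ncard_image Ff sinj; rewrite (ncardE FY).
set I := _ @` _; have -> : I = [set z | X z.1 /\ Y z.2 /\ r z.1 z.2].
  apply/seteqP; split=> -[a b] /=.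
    by move=> [[c d] /= [Yc [Xd rd]] [<- <-]].
  by case=> [Xa [Yb rab]]; exists (b, a).
by rewrite FX => /eqP; rewrite eqn_pmul2l // => /eqP.
Qed.

(** * Joins, modularity and codimension in a projective geometry *)

Section ProjectiveGeometry.
Variable P : projGeom.
Implicit Types (W K t s X : set P) (p q x y z : P).

Lemma collinearC p q r : collinear p q r -> collinear q p r.
Proof. by case=> l [? ? ? ?]; exists l. Qed.

Lemma collinearCr p q r : collinear p q r -> collinear p r q.
Proof. by case=> l [? ? ? ?]; exists l. Qed.

Lemma collinear_refl p q : p <> q -> collinear p q q.
Proof. by case/line_exists=> l [? ? ?]; exists l. Qed.

Lemma subspace_collinear W p q r :
  subspace W -> W p -> W q -> p <> q -> collinear p q r -> W r.
Proof. by move=> Ws Wp Wq pq [l [ll lp lq lr]]; exact: (Ws p q l). Qed.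

Lemma subspaceT : subspace [set: P].
Proof. by []. Qed.

Lemma subspace_bigcap (I : Type) (F : I -> set P) (D : set I) :
  (forall i, D i -> subspace (F i)) -> subspace (\bigcap_(i in D) F i).
Proof.
move=> Fs p q l pq Fp Fq ll lp lq r lr i Di.
by apply: (Fs i Di p q l) => //; [exact: Fp | exact: Fq].
Qed.

Lemma subspaceI W K : subspace W -> subspace K -> subspace (W `&` K).
Proof.
move=> Ws Ks p q l pq [Wp Kp] [Wq Kq] ll lp lq r lr.
by split; [apply: (Ws p q l) | apply: (Ks p q l)].
Qed.

Lemma subspace_Span X : subspace (Span X).
Proof. by apply: subspace_bigcap => W []. Qed.

Lemma sub_Span X : X `<=` Span X.
Proof. exact: sub_gen_smallest. Qed.

Lemma Span_sub X W : subspace W -> X `<=` W -> Span X `<=` W.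
Proof. exact: smallest_sub. Qed.

Lemma subset_Span X Y : X `<=` Y -> Span X `<=` Span Y.
Proof.
by move=> XY; apply: Span_sub (@subspace_Span _) _ => x /XY; exact: sub_Span.
Qed.

Lemma Span_id W : subspace W -> Span W = W.
Proof. exact: smallest_id. Qed.

Lemma Span_SpanU X Y : Span (Span X `|` Y) = Span (X `|` Y).
Proof.
apply/seteqP; split; last first.
  by apply: subset_Span => z [Xz|Yz]; [left; exact: sub_Span|right].
apply: Span_sub (@subspace_Span _) _ => z [|Yz]; last by apply: sub_Span; right.
by apply: subset_Span => y Xy; left.
Qed.

(** * Join of a subspace with a point *)

Definition jn W x := Span (W `|` [set x]).

Lemma subspace_jn W x : subspace (jn W x).
Proof. exact: subspace_Span. Qed.

Lemma sub_jn W x : W `<=` jn W x.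
Proof. by move=> z Wz; apply: sub_Span; left. Qed.

Lemma jn_in W x : jn W x x.
Proof. by apply: sub_Span; right. Qed.

Lemma jn_sub W x K : subspace K -> W `<=` K -> K x -> jn W x `<=` K.
Proof. by move=> Ks WK Kx; apply: Span_sub => // z [/WK|->]. Qed.

Lemma jn_id W x : subspace W -> W x -> jn W x = W.
Proof. by move=> Ws Wx; apply/seteqP; split; [exact: jn_sub|exact: sub_jn]. Qed.

Lemma jnAC W x y : jn (jn W x) y = jn (jn W y) x.
Proof.
by rewrite /jn !Span_SpanU -!setUA (setUC [set x]).
Qed.

Lemma veblen_line (a b c d : P) (ab cd ac bd : set P) :
  a <> b -> a <> c -> a <> d -> b <> c -> b <> d -> c <> d ->
  lines ab -> lines cd -> lines ac -> lines bd ->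
  ab a -> ab b -> cd c -> cd d -> ac a -> ac c -> bd b -> bd d ->
  (exists2 z, ab z & cd z) -> exists2 z, ac z & bd z.
Proof.
move=> nab nac nad nbc nbd ncd lab lcd lac lbd aab bab.
move=> ccd dcd aac cac bbd dbd [z abz cdz].
have [|||||||y [? ?]] := @veblen P a b c d ab cd ac bd; last by exists y.
all: try by [].
- by repeat (constructor; first by rewrite /=; intuition congruence); constructor.
- by exists z.
Qed.

(** An explicit form of the join, made of the lines from [x] to [W]; unlike membership in [Span],
    membership here can be taken apart. *)
Definition cone W x : set P := [set z | z = x \/ exists2 y, W y & collinear x y z].

Lemma cone_line W x l z : lines l -> l x -> (exists2 y, W y & l y) -> l z ->
  cone W x z.
Proof. by move=> ll lx [y Wy ly] lz; right; exists y => //; exists l. Qed.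

(** Two points of the cone not in line with [x] sit on lines [m1], [m2] from [x] to [y1], [y2].
    Veblen's axiom makes the line [l] through them meet the line [m] through [y1], [y2] in a point
    [u] of [W]. A second use shows that the line from [x] to any [z] on [l] meets [m] too. *)
Lemma subspace_cone W x : subspace W -> ~ W x -> subspace (cone W x).
Proof.
move=> Ws nWx.
have Wline (y1 y2 : P) m z : W y1 -> W y2 -> y1 <> y2 -> lines m -> m y1 -> m y2 ->
    m z -> W z by move=> *; apply: (Ws y1 y2 m).
have xW y : W y -> x <> y by move=> Wy e; apply: nWx; rewrite e.
have WC z : W z -> cone W x z.
  move=> Wz; right; exists z => //; apply: collinear_refl; exact: xW.
have thru l z1 z : lines l -> l x -> l z1 -> cone W x z1 -> x <> z1 -> l z ->
    cone W x z.
  move=> ll lx lz1 [/esym //|[y Wy [m [lm mx my mz1]]]] xz1 lz.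
  rewrite (line_unique xz1 ll lm) // in lz.
  by right; exists y => //; exists m.
move=> z1 z2 l nz12 C1 C2 ll l1 l2 z lz.
have [ex|nzx] := pselect (x = z); first by rewrite -ex; left.
have [lx|nlx] := pselect (l x).
  have [e|] := pselect (x = z1); last by move=> n; exact: (thru l z1).
  by apply: (thru l z2) => //; rewrite e.
case: C1 C2 => [e|[y1 W1 [m1 [lm1 m1x m1y m1z]]]].
  by rewrite e in l1.
case=> [e|[y2 W2 [m2 [lm2 m2x m2y m2z]]]]; first by rewrite e in l2.
have [/WC //|nWz] := pselect (W z).
have [e12|n12] := pselect (y1 = y2).
  subst y2; have e : m1 = m2 by apply: (line_unique (xW _ W1)).
  subst m2; by case: nlx; rewrite (line_unique nz12 ll lm1).
have [m [lm my1 my2]] := line_exists n12.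
have mW u : m u -> W u by exact: (Wline y1 y2).
have nmx : ~ m x by move/mW.
have nx1 : x <> z1 by move=> e; rewrite e in nlx.
have nx2 : x <> z2 by move=> e; rewrite e in nlx.
have nm12 u : m1 u -> m2 u -> x = u.
  move=> u1 u2; apply: contrapT => nxu.
  apply: nmx; suff em : m1 = m2 by rewrite (line_unique n12 lm lm1) // em.
  exact: (line_unique nxu).
have n1 : z1 <> y2 by move=> e; apply: nx1; apply: nm12 => //; rewrite e.
have n2 : z2 <> y1 by move=> e; apply: nx2; apply: nm12 => //; rewrite e.
have [u mu lu] : exists2 u, m u & l u.
  have [e1|e1] := pselect (y1 = z1); first by exists y1; rewrite // e1.
  have [e2|e2] := pselect (y2 = z2); first by exists y2; rewrite // e2.
  apply: (@veblen_line y1 z1 y2 z2 m1 m2) => //; try by move/esym.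
  by exists x.
have Wu := mW u mu.
have nuz : z <> u by move=> e; apply: nWz; rewrite e.
have [k [lk kx kz]] := line_exists nzx.
(* A second use of Veblen's axiom, with whichever of y1, y2 differs from u. *)
suff [y yk ym] : exists2 y, k y & m y.
  by apply: (cone_line lk) => //; exists y => //; exact: mW.
have [e1|e1] := pselect (y1 = u).
  have e2 : y2 <> u by rewrite -e1 => /esym.
  apply: (@veblen_line x y2 z u m2 l) => //.
  - exact: xW.
  - exact: xW.
  - by move=> e; apply: nWz; rewrite -e.
  - by exists z2.
apply: (@veblen_line x y1 z u m1 l) => //.
- exact: xW.
- exact: xW.
- by move=> e; apply: nWz; rewrite -e.
- by exists z1.
Qed.

Lemma jnP W x z : subspace W -> ~ W x -> jn W x z ->
  z = x \/ exists2 y, W y & collinear x y z.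
Proof.
move=> Ws nWx; apply: (Span_sub (subspace_cone Ws nWx)) => {}z [Wz|->].
  right; exists z => //; apply: collinear_refl => e; apply: nWx; by rewrite e.
by left.
Qed.

(** Steinitz exchange: unless [y = x], the point [y] lies on a line from [x] to some [w] in [W], and
    that line also passes through the distinct points [w] and [y]. *)
Lemma jn_exchange W x y : subspace W -> jn W x y -> ~ W y -> jn W y x.
Proof.
move=> Ws; have [Wx|nWx] := pselect (W x).
  by move=> Wy nWy; rewrite jn_id // in Wy.
case/(jnP Ws nWx) => [->|[w Ww c]] nWy; first exact: jn_in.
have nwy : w <> y by move=> e; apply: nWy; rewrite -e.
apply: (@subspace_collinear _ w y); rewrite //.
- exact: subspace_jn.
- exact: sub_jn.
- exact: jn_in.
- exact/collinearCr/collinearC.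
Qed.

Lemma jn_eq W x y : subspace W -> jn W x y -> ~ W y -> jn W y = jn W x.
Proof.
move=> Ws Wxy nWy; apply/seteqP; split; apply: jn_sub; rewrite //;
  by [exact: subspace_jn|exact: sub_jn|exact: jn_exchange].
Qed.

(** Modular law for a point [x] of [K]: if [z] in [K], other than [x], lies on the line from [x] to
    [w] in [W], that line is contained in [K], so [w] is in [K] as well. *)
Lemma setI_jn K W x : subspace K -> subspace W -> K x ->
  K `&` jn W x = jn (K `&` W) x.
Proof.
move=> Ks Ws Kx; apply/seteqP; split; last first.
  apply: jn_sub; first by apply: subspaceI => //; exact: subspace_jn.
    by move=> z [Kz Wz]; split=> //; exact: sub_jn.
  by split=> //; exact: jn_in.
have [Wx|nWx] := pselect (W x); first by rewrite jn_id //; exact: sub_jn.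
move=> z [Kz]; case/(jnP Ws nWx) => [->|[w Ww c]]; first exact: jn_in.
have [->|nxz] := pselect (z = x); first exact: jn_in.
have Kw : K w.
  apply: (subspace_collinear Ks Kx Kz); last exact: collinearCr.
  by move=> e; apply: nxz.
apply: (@subspace_collinear _ x w) => //.
- exact: subspace_jn.
- exact: jn_in.
- exact: sub_jn.
- by move=> e; apply: nWx; rewrite e.
Qed.

Lemma setI_jn_notin K W x : subspace K -> subspace W -> W `<=` K -> ~ K x ->
  K `&` jn W x `<=` W.
Proof.
move=> Ks Ws WK nKx z [Kz].
case/jnP => // [/WK //|e|[w Ww c]]; first by rewrite -e in nKx.
have [-> //|nwz] := pselect (z = w).
case: nKx; apply: (@subspace_collinear _ w z) => //.
- exact: WK.
- by move=> /esym.
- exact/collinearCr/collinearC.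
Qed.

(* Unlike [codim], which is 0 on subspaces of infinite codimension, [cod n t]
   certifies that the codimension is finite. *)
Fixpoint cod n t : Prop :=
  if n is m.+1 then exists2 x, ~ t x & cod m (jn t x) else t = setT.

Lemma cod_jn n t x : subspace t -> cod n t -> ~ t x ->
  exists2 m, n = m.+1 & cod m (jn t x).
Proof.
elim: n t => [|n IH] t ts /=; first by move=> -> /(_ I).
case=> y nty cy ntx; have [xy|nxy] := pselect (jn t y x).
  by exists n; rewrite // (jn_eq ts xy ntx).
have [m nm cm] := IH _ (@subspace_jn _ _) cy nxy; exists n => //.
rewrite nm; exists y; last by rewrite jnAC.
by move=> /(jn_exchange ts)/(_ nty).
Qed.

Lemma cod_uniq n m t : subspace t -> cod n t -> cod m t -> n = m.
Proof.
elim: n m t => [|n IH] m t ts /=.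
  by move=> ->; case: m => //= m [x] /(_ I).
case=> x ntx cx cm; have [k -> ck] := cod_jn ts cm ntx.
by rewrite (IH _ _ (@subspace_jn _ _) cx ck).
Qed.

Lemma cod_jnS n t x : ~ t x -> cod n (jn t x) -> cod n.+1 t.
Proof. by move=> ntx c; exists x. Qed.

(** The last clause records strictness, from which [cod_eq] recovers equality of nested flats from
    equality of codimensions. *)
Lemma cod_sub n t s : subspace t -> subspace s -> t `<=` s -> cod n t ->
  exists m, [/\ (m <= n)%N, cod m s & m = n -> s = t].
Proof.
elim: n t => [|n IH] t ts ss tss.
  move=> /= tT; have sT : s = setT.
    by apply/seteqP; split=> // z _; apply: tss; rewrite tT.
  by exists 0; split=> //; rewrite tT sT.
move=> ct; have [st|] := pselect (s `<=` t).
  by exists n.+1; suff -> : s = t by []; apply/seteqP.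
case/existsNP=> x /not_implyP[sx ntx].
have [k [ek] cx] := cod_jn ts ct ntx; subst k.
have [m [mn cm _]] := IH _ (@subspace_jn _ _) ss (jn_sub ss tss sx) cx.
by exists m; split=> //; lia.
Qed.

Lemma cod_eq n t s : subspace t -> subspace s -> t `<=` s -> cod n t -> cod n s ->
  s = t.
Proof.
move=> ts ss tss ct cs; have [m [_ cm]] := cod_sub ts ss tss ct; apply.
exact: cod_uniq cm cs.
Qed.

(** Induction on the codimension of [s]. Joining to [s] a point of [t] outside it lowers the
    codimensions of [s] and, by the modular law, of the intersection by one each, and leaves the
    span of the union unchanged. The process stops once [t] lies in [s]. *)
Lemma cod_modular n m t s : subspace t -> subspace s -> cod n t -> cod m s ->
  exists a b, [/\ cod a (t `&` s), cod b (Span (t `|` s)) & a + b = n + m].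
Proof.
move=> ts + ct; elim: m s => [|m IH] s ss cs.
  move: cs => /= ->; exists n, 0; rewrite setIT setUT addn0; split=> //=.
  exact: Span_id.
have [tss|] := pselect (t `<=` s).
  by exists n, m.+1; rewrite (setIidl tss) (setUidr tss) Span_id.
case/existsNP=> x /not_implyP[tx nsx].
have [k [ek] cx] := cod_jn ss cs nsx; subst k.
have [a [b [ca cb ab]]] := IH _ (@subspace_jn _ _) cx.
exists a.+1, b; split; last by lia.
- by apply: (@cod_jnS _ _ x); [case|rewrite -setI_jn].
- move: cb; suff -> : Span (t `|` jn s x) = Span (t `|` s) by [].
  rewrite (setUC t (jn s x)) /jn Span_SpanU; congr Span.
  by apply/seteqP; split=> z /=; [case=> [[|->]|]|]; tauto.
Qed.

Lemma cod_ext n t : subspace t -> cod n t ->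
  exists s : seq P, size s = n /\ forall K, subspace K -> t `<=` K ->
    (forall x, List.In x s -> K x) -> K = setT.
Proof.
elim: n t => [|n IH] t ts /=.
  by move=> ->; exists [::]; split=> // K _ tK _; apply/seteqP; split.
case=> x _ cx; have [s [ss sK]] := IH _ (@subspace_jn _ _) cx.
exists (x :: s); split; first by rewrite /= ss.
move=> K Ks tK sxK; apply: sK => //; last by move=> y ys; apply: sxK; right.
by apply: jn_sub => //; apply: sxK; left.
Qed.

Lemma spanning_cod X t : finite_set X -> subspace t -> Span (t `|` X) = setT ->
  exists2 n, (n <= ncard X)%N & cod n t.
Proof.
move=> Xf; move: X Xf t; apply: finite_set_induct => [|x X Xf nXx IH] t ts.
  by rewrite setU0 Span_id // => ->; exists 0.
rewrite setUA -Span_SpanU => /(IH _ (@subspace_jn _ _))[n nX cn].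
rewrite ncardU1 //; have [tx|ntx] := pselect (t x).
  by exists n; [lia|rewrite -(jn_id ts tx)].
by exists n.+1 => //; exists x.
Qed.

(** Ties the chains of [cod] to least spanning extensions: [spanning_cod] bounds the size of every
    extension from below, and [cod_ext] supplies one attaining the bound. *)
Lemma codimE n t : subspace t -> cod n t -> codim t = n.
Proof.
move=> ts ct.
have least X m : X #= `I_m -> Span (t `|` X) = setT -> (n <= m)%N.
  move=> Xm XT; have [k km ck] : exists2 k, (k <= ncard X)%N & cod k t.
    by apply: spanning_cod => //; apply/finite_setP; exists m.
  by rewrite (cod_uniq ts ct ck) -(ncardE Xm).
have [s [sn sK]] := cod_ext ts ct.
(* The list may repeat points, so at first its set only has at most [n] elements; equality follows
   from the lower bound. *)
have [X [Xf sX Xn]] : exists X, [/\ finite_set X, (forall x, List.In x s -> X x)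
    & (ncard X <= n)%N].
  rewrite -sn; elim: s {sn sK} => [|x s [X [Xf sX Xn]]].
    by exists set0; rewrite ncard0; split=> //; exact: finite_set0.
  exists (x |` X); split; first by rewrite finite_setU; split=> //; exact: finite_set1.
    by move=> y [->|/sX Xy]; [left|right].
  have [Xx|nXx] := pselect (X x); last by rewrite ncardU1.
  by rewrite setUidr => [|_ -> //]; rewrite /=; lia.
have XT : Span (t `|` X) = setT.
  apply: sK; first exact: subspace_Span.
    by move=> z tz; apply: sub_Span; left.
  by move=> z /sX Xz; apply: sub_Span; right.
have eX : ncard X = n.
  by apply/eqP; rewrite eqn_leq Xn (least X) //; exact: card_ncard.
apply: xget_unique.
  split; first by exists X; split=> //; rewrite -eX; exact: card_ncard.
  by move=> m [Y [Ym YT]]; apply: least Ym YT.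
move=> m [[Y [Ym YT]] mmin]; apply/eqP; rewrite eqn_leq (least Y) // andbT.
by apply: mmin; exists X; split=> //; rewrite -eX; exact: card_ncard.
Qed.

(** * Hyperplanes and intersections of finite families *)

Definition hyperplane W := subspace W /\ cod 1 W.

Lemma jn_hyperplane W x : hyperplane W -> ~ W x -> jn W x = setT.
Proof. by case=> Ws cW nWx; have [k [<-]] := cod_jn Ws cW nWx. Qed.

Lemma hyperplane_neqT W : hyperplane W -> W <> setT.
Proof. by case=> _ [x nWx _] e; apply: nWx; rewrite e. Qed.

(** For [x] in [t] outside [W], the modular law turns the join of the intersection with [x] back
    into [t]. *)
Lemma hyperplaneI n t W : hyperplane W -> subspace t -> cod n t -> ~ t `<=` W ->
  cod n.+1 (t `&` W).
Proof.
move=> Wh ts ct /existsNP[x /not_implyP[tx nWx]].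
apply: (@cod_jnS _ _ x); first by case.
by rewrite -setI_jn //; [rewrite (jn_hyperplane Wh nWx) setIT|case: Wh].
Qed.

Section HyperplaneFamily.
Variables (I : Type) (F : I -> set P).

Lemma cod_bigcap (S : set I) : finite_set S -> (forall i, S i -> hyperplane (F i)) ->
  exists2 n, (n <= ncard S)%N & cod n (\bigcap_(i in S) F i).
Proof.
move: S; apply: finite_set_induct => [_|i S Sf nSi IH Fh].
  by exists 0 => //=; rewrite bigcap_set0.
have [n nS cn] : exists2 n, (n <= ncard S)%N & cod n (\bigcap_(i in S) F i).
  by apply: IH => j Sj; apply: Fh; right.
have Ss : subspace (\bigcap_(i in S) F i).
  by apply: subspace_bigcap => j Sj; case: (Fh j); [right|].
have Fi : hyperplane (F i) by apply: Fh; left.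
rewrite ncardU1 // bigcap_setU1 setIC.
have [SF|nSF] := pselect (\bigcap_(i in S) F i `<=` F i).
  by rewrite (setIidl SF); exists n => //; lia.
by exists n.+1 => //; exact: hyperplaneI.
Qed.

Lemma cod_codim_bigcap (S : set I) :
  finite_set S -> (forall i, S i -> hyperplane (F i)) ->
  cod (codim (\bigcap_(i in S) F i)) (\bigcap_(i in S) F i).
Proof.
move=> Sf Fh; have [n _ cn] := cod_bigcap Sf Fh.
by rewrite (codimE _ cn) //; apply: subspace_bigcap => i /Fh[].
Qed.

(** Submodularity is modularity of [cod] together with the fact that the flat of the common members
    contains the span of both flats. Indexed families cover both the edges of the graph and the
    hyperplanes themselves. *)
Lemma codim_bigcap_matroid (S U : set I) : finite_set S -> finite_set U ->
  (forall i, S i -> hyperplane (F i)) -> (forall i, U i -> hyperplane (F i)) ->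
  [/\ (codim (\bigcap_(i in S) F i) <= ncard S)%N,
      S `<=` U ->
        (codim (\bigcap_(i in S) F i) <= codim (\bigcap_(i in U) F i))%N
    & (codim (\bigcap_(i in S `|` U) F i) + codim (\bigcap_(i in S `&` U) F i) <=
       codim (\bigcap_(i in S) F i) + codim (\bigcap_(i in U) F i))%N].
Proof.
move=> Sf Uf Sh Uh.
have Ss : subspace (\bigcap_(i in S) F i) by apply: subspace_bigcap => i /Sh[].
have Us : subspace (\bigcap_(i in U) F i) by apply: subspace_bigcap => i /Uh[].
have cS := cod_codim_bigcap Sf Sh; have cU := cod_codim_bigcap Uf Uh.
split.
- by have [n nS cn] := cod_bigcap Sf Sh; rewrite (codimE Ss cn).
- move=> SU; have [|m [mU cm _]] := cod_sub Us Ss _ cU; last by rewrite (codimE Ss cm).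
  by move=> z Uz i /SU; exact: Uz.
- have [a [b [ca cb <-]]] := cod_modular Ss Us cS cU.
  rewrite bigcap_setU (codimE _ ca) ?leq_add2l; last exact: subspaceI.
  have Is : subspace (\bigcap_(i in S `&` U) F i).
    by apply: subspace_bigcap => i [/Sh[]].
  have [|m [mb cm _]] := cod_sub (@subspace_Span _) Is _ cb.
    by apply: Span_sub => // z [Sz i [Si _]|Uz i [_ Ui]]; [exact: Sz|exact: Uz].
  by rewrite (codimE Is cm).
Qed.

End HyperplaneFamily.
End ProjectiveGeometry.

(** * Walks, circles, thetas and components *)

Section GraphTheory.
Variables (N E : Type) (G : graph N E).
Hypothesis Ggraph : is_graph G.
Implicit Types (S C D T : set E) (v w x u a b : N) (e f : E) (p q r : seq (E * N)).

Lemma link_incident e v w : link G e v w ->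
  forall x, incident G e x <-> x = v \/ x = w.
Proof.
move=> l x; case: (Ggraph e) => [[a [_ /(_ v w)//]]|[a [b [ab nh lE]]]].
have /lE[[? ?]|[? ?]] := l; subst v w; split.
- by case=> [/nh//|[y /lE]]; tauto.
- by case=> ->; right; [exists b|exists a]; apply/lE; tauto.
- by case=> [/nh//|[y /lE]]; tauto.
- by case=> ->; right; [exists a|exists b]; apply/lE; tauto.
Qed.

Lemma link_neq e v w : link G e v w -> v <> w.
Proof.
move=> l; case: (Ggraph e) => [[a [_ /(_ v w)//]]|[a [b [ab nh lE]]]].
by have /lE[[-> ->]|[-> ->]] := l => // /esym.
Qed.

Lemma link_sym e v w : link G e v w -> link G e w v.
Proof.
move=> l; case: (Ggraph e) => [[a [_ /(_ v w)//]]|[a [b [ab nh lE]]]].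
by apply/lE; move/lE: l; tauto.
Qed.

Lemma link_not_half e v w x : link G e v w -> ~ Defs.half G e x.
Proof.
by move=> l; case: (Ggraph e) => [[a [_ /(_ v w)//]]|[a [b [ab nh lE]]]].
Qed.

Lemma half_incident e v : Defs.half G e v -> forall x, incident G e x <-> x = v.
Proof.
move=> h x; case: (Ggraph e) => [[a [hE nl]]|[a [b [ab /(_ v)//]]]].
have /hE -> := h; split; last by move=> ->; left; apply/hE.
by case=> [/hE//|[y /nl]].
Qed.

Lemma edge_cases e : (exists v, Defs.half G e v) \/ exists v w, link G e v w.
Proof.
case: (Ggraph e) => [[a [hE _]]|[a [b [_ _ lE]]]].
  by left; exists a; apply/hE.
by right; exists a, b; apply/lE; left.
Qed.

Lemma finite_ends e : finite_set [set v | incident G e v].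
Proof.
case: (edge_cases e) => [[v h]|[v [w l]]].
  by apply: sub_finite_set (finite_set1 v) => x /(half_incident h).
by apply: sub_finite_set (finite_set2 v w) => x /(link_incident l).
Qed.

Lemma nodes_ofU S T : nodes_of G (S `|` T) = nodes_of G S `|` nodes_of G T.
Proof.
apply/seteqP; split=> x.
  by case=> e [Se|Te] i; [left|right]; exists e.
by case=> -[e Se i]; exists e => //; [left|right].
Qed.

Lemma nodes_of_sub S T : S `<=` T -> nodes_of G S `<=` nodes_of G T.
Proof. by move=> ST x [e /ST Te i]; exists e. Qed.

Lemma nodes_of0 : nodes_of G set0 = set0.
Proof. by rewrite -subset0 => x []. Qed.

Lemma finite_nodes_of S : finite_set S -> finite_set (nodes_of G S).
Proof.
move=> Sf; have -> : nodes_of G S = \bigcup_(e in S) [set v | incident G e v].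
  by apply/seteqP; split=> x [e Se i]; exists e.
by apply: bigcup_finite => // e _; exact: finite_ends.
Qed.

Lemma nodes_of_neq0 S : S !=set0 -> nodes_of G S !=set0.
Proof.
case=> e Se; case: (edge_cases e) => [[v h]|[v [w l]]]; exists v, e => //.
  by left.
by right; exists w.
Qed.

Lemma walk_edges_cons e u p : walk_edges ((e, u) :: p) = e |` walk_edges p.
Proof.
by apply/seteqP; split=> f; case=> [/= ->|pf]; by [left|right].
Qed.

Lemma walk_edges_nil : walk_edges ([::] : seq (E * N)) = set0.
Proof. by []. Qed.

Lemma walk_edges_cat p q : walk_edges (p ++ q) = walk_edges p `|` walk_edges q.
Proof.
elim: p => [|[e u] p IH]; first by rewrite walk_edges_nil set0U.
by rewrite cat_cons !walk_edges_cons IH setUA.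
Qed.

Lemma finite_walk_edges p : finite_set (walk_edges p).
Proof.
elim: p => [|[e u] p IH]; first exact: finite_set0.
by rewrite walk_edges_cons finite_setU; split=> //; exact: finite_set1.
Qed.

Lemma walk_cat v p u q w : walk G v p u -> walk G u q w -> walk G v (p ++ q) w.
Proof.
by elim: p v => [|[e a] p IH] v /=; [move=> ->|case=> l wp wq; split=> //; exact: IH].
Qed.

Lemma walk_edge_link v p w e : walk G v p w -> walk_edges p e ->
  exists a b, link G e a b.
Proof.
elim: p v => [|[f a] p IH] v //= [l wp]; rewrite walk_edges_cons => -[->|pe].
  by exists v, a.
exact: IH wp pe.
Qed.

Lemma joined_refl S v : joined G S v v.
Proof. by exists [::]. Qed.

Lemma joined_sub S T v w : S `<=` T -> joined G S v w -> joined G T v w.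
Proof. by move=> ST [p wp pS]; exists p => // e /pS /ST. Qed.

Lemma joined_trans S v u w : joined G S v u -> joined G S u w -> joined G S v w.
Proof.
move=> [p wp pS] [q wq qS]; exists (p ++ q); first exact: walk_cat wp wq.
by rewrite walk_edges_cat subUset.
Qed.

Lemma joined_link S e v w : S e -> link G e v w -> joined G S v w.
Proof. by move=> Se l; exists [:: (e, w)] => // f [<-|]. Qed.

Lemma joined_sym S v w : joined G S v w -> joined G S w v.
Proof.
case=> p; elim: p v => [|[e a] p IH] v /=; first by move=> ->; exists [::].
case=> l wp; rewrite walk_edges_cons subUset => -[Se pS].
apply: (joined_trans (IH a wp pS)).
by apply: (@joined_link _ e); [exact: Se|exact: link_sym].
Qed.

Lemma joined_nodes S v w : nodes_of G S v -> joined G S v w -> nodes_of G S w.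
Proof.
move=> + [p]; elim: p v => [|[e a] p IH] v Sv /=; first by move=> <-.
case=> l wp; rewrite walk_edges_cons subUset => -[Se pS].
apply: IH wp pS; exists e; first exact: Se.
by apply/(link_incident l); right.
Qed.

Lemma walk_nodes_last v p w : walk G v p w -> List.In w (walk_nodes v p).
Proof.
elim: p v => [|[e a] p IH] v /=; first by left.
by case=> _ /IH; right.
Qed.

Lemma walk_nodes_joined v p w x : walk G v p w -> List.In x (walk_nodes v p) ->
  joined G (walk_edges p) v x.
Proof.
elim: p v => [|[e a] p IH] v /=; first by move=> _ [->|//]; exact: joined_refl.
case=> l wp [->|xp]; first exact: joined_refl.
rewrite walk_edges_cons; apply: (@joined_trans _ _ a).
  by apply: (joined_link _ l); left.
by apply: (joined_sub _ (IH _ wp xp)) => f; right.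
Qed.

Lemma nodes_of_walk_sub v p w x : walk G v p w -> nodes_of G (walk_edges p) x ->
  List.In x (walk_nodes v p).
Proof.
elim: p v => [|[e a] p IH] v /=; first by move=> _ [].
case=> l wp; rewrite walk_edges_cons nodes_ofU => -[[f ->]|/(IH _ wp)]; last by right.
by move=> /(link_incident l)[->|->]; [left|right; left].
Qed.

Lemma nodes_of_walk v p w x : walk G v p w -> v <> w ->
  nodes_of G (walk_edges p) x <-> List.In x (walk_nodes v p).
Proof.
move=> wp vw; split; first exact: nodes_of_walk_sub wp.
move=> /(walk_nodes_joined wp); apply: joined_nodes.
case: p wp => [//|[e a] p] [l _]; exists e; first by left.
by apply/(link_incident l); left.
Qed.

Lemma connected_walk v p w : walk G v p w -> connected G (walk_edges p).
Proof.
move=> wp a b /(nodes_of_walk_sub wp) ap /(nodes_of_walk_sub wp) bp.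
apply: (@joined_trans _ _ v); last exact: walk_nodes_joined wp bp.
by apply/joined_sym/(walk_nodes_joined wp ap).
Qed.

Lemma connectedU S T x : nodes_of G S x -> nodes_of G T x ->
  connected G S -> connected G T -> connected G (S `|` T).
Proof.
move=> Sx Tx cS cT.
suff jx a : nodes_of G (S `|` T) a -> joined G (S `|` T) a x.
  by move=> a b /jx ja /jx jb; apply: joined_trans ja (joined_sym jb).
rewrite nodes_ofU => -[Sa|Ta].
- by apply: joined_sub (cS _ _ Sa Sx) => e; left.
- by apply: joined_sub (cT _ _ Ta Tx) => e; right.
Qed.

Lemma path_suffix v p w x : is_path G v p w -> List.In x (walk_nodes v p) ->
  exists2 q, is_path G x q w & walk_edges q `<=` walk_edges p.
Proof.
elim: p v => [|[e a] p IH] v [] /=.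
  by move=> vw nd [<-|//]; exists [::].
case=> l wp nd [<-|xp]; first by exists ((e, a) :: p).
have [|q qp qe] := IH a _ xp; last by exists q => // f /qe; right.
by split=> //; case/List.NoDup_cons_iff: nd.
Qed.

(** Loop erasure: when the new first node already occurs on the path, the path is replaced by its
    suffix from there. *)
Lemma joined_path S v w : joined G S v w ->
  exists2 p, is_path G v p w & walk_edges p `<=` S.
Proof.
case=> p; elim: p v => [|[e a] p IH] v /=.
  move=> -> _; exists [::] => //; split=> //=; by repeat constructor.
case=> l wp; rewrite walk_edges_cons subUset => -[Se pS].
have [q qp qS] := IH a wp pS.
have [vq|nvq] := pselect (List.In v (walk_nodes a q)).
  by have [r rp rS] := path_suffix qp vq; exists r => // f /rS /qS.
case: qp => wq nd; exists ((e, a) :: q); last by rewrite walk_edges_cons subUset.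
by split=> //; constructor.
Qed.

Lemma is_path_cons e a v p w : is_path G v ((e, a) :: p) w <->
  [/\ link G e v a, is_path G a p w & ~ List.In v (walk_nodes a p)].
Proof.
split; first by case=> -[l wp] /List.NoDup_cons_iff[].
by case=> l [wp nd] nv; split=> //; constructor.
Qed.

Lemma path_loop v p : is_path G v p v -> p = [::].
Proof.
case: p => [//|[e a] p] /is_path_cons[_ [/walk_nodes_last]] //.
Qed.

(** * Degrees, circles and the circles inside a theta *)

Definition inc_edges C x : set E := [set e | C e /\ incident G e x].
Definition deg C x := ncard (inc_edges C x).

Lemma finite_inc_edges C x : finite_set C -> finite_set (inc_edges C x).
Proof. by apply: sub_finite_set => e []. Qed.

Lemma degU C D x : finite_set C -> finite_set D -> C `&` D = set0 ->
  deg (C `|` D) x = deg C x + deg D x.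
Proof.
move=> Cf Df CD; rewrite -ncardU; last 1 first.
- by rewrite -subset0 -CD => e [[? _] [? _]].
- by congr ncard; apply/seteqP; split=> e; rewrite /inc_edges /=; tauto.
- exact: finite_inc_edges.
- exact: finite_inc_edges.
Qed.

Lemma deg_notin C x : ~ nodes_of G C x -> deg C x = 0.
Proof.
move=> nx; rewrite /deg -[RHS](@ncard0 E); congr ncard; rewrite -subset0.
by move=> e [Ce i]; apply: nx; exists e.
Qed.

Lemma deg1 e x : incident G e x -> deg [set e] x = 1.
Proof.
move=> i; apply: ncardE; have -> : inc_edges [set e] x = [set e].
  by apply/seteqP; split=> f; [case|move=> ->].
exact: card_set1.
Qed.

Lemma path_deg v p w : is_path G v p w -> v <> w ->
  [/\ deg (walk_edges p) v = 1, deg (walk_edges p) w = 1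
    & forall x, List.In x (walk_nodes v p) -> x <> v -> x <> w ->
        deg (walk_edges p) x = 2].
Proof.
elim: p v => [|[e a] p IH] v; first by case=> /= ->.
case/is_path_cons=> l pp nv vw.
have [wp nd] := pp.
have nve : ~ nodes_of G (walk_edges p) v by move/(nodes_of_walk_sub wp).
have iv : incident G e v by apply/(link_incident l); left.
have ia : incident G e a by apply/(link_incident l); right.
have dU x : deg (walk_edges ((e, a) :: p)) x = deg [set e] x + deg (walk_edges p) x.
  rewrite walk_edges_cons degU //; first exact: finite_walk_edges.
  by rewrite -subset0 => f [-> pe]; apply: nve; exists e.
have d0 x : x <> v -> x <> a -> deg [set e] x = 0.
  by move=> xv xa; apply: deg_notin => -[f -> /(link_incident l)[]].
have [aw|aw] := pselect (a = w).
  subst w; rewrite (path_loop pp) in dU *.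
  have d00 x : deg (walk_edges ([::] : seq (E * N))) x = 0.
    by apply: deg_notin; rewrite walk_edges_nil nodes_of0.
  by split=> [||x /= [->|[->|//]]] //; rewrite dU d00 deg1.
have [da dw dx] := IH a pp aw; split; rewrite ?dU.
- by rewrite deg1 // (deg_notin nve).
- by rewrite d0 ?dw // => /esym.
- move=> x /= xp xv xw; rewrite dU; have [->|xa] := pselect (x = a).
    by rewrite deg1 // da.
  by rewrite d0 // dx //; case: xp => [/esym//|].
Qed.

Lemma deg_card C x : finite_set C -> deg C x = 2 ->
  [set e | C e /\ incident G e x] #= `I_2.
Proof. by move=> Cf <-; apply/card_ncard/finite_inc_edges. Qed.

(** Degrees add over edge-disjoint paths: one plus one at [v] and [w], and two plus zero at an inner
    node, which lies on only one of the paths. *)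
Lemma circle_paths v w p q : v <> w -> is_path G v p w -> is_path G v q w ->
  internally_disjoint v w p q -> circle G (walk_edges p `|` walk_edges q).
Proof.
move=> vw pp pq [de dn].
have [wp _] := pp; have [wq _] := pq.
have np x := @nodes_of_walk v p w x wp vw.
have nq x := @nodes_of_walk v q w x wq vw.
have pv : nodes_of G (walk_edges p) v by apply/np; left.
have qv : nodes_of G (walk_edges q) v by apply/nq; left.
have pf := finite_walk_edges p; have qf := finite_walk_edges q.
split.
- by rewrite finite_setU.
- by case: pv => e pe _; exists e; left.
- by move=> e x [/(walk_edge_link wp)|/(walk_edge_link wq)] [a [b /link_not_half]]; apply.
- exact: connectedU pv qv (connected_walk wp) (connected_walk wq).
move=> x; rewrite nodes_ofU => pqx; apply: deg_card; first by rewrite finite_setU.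
rewrite degU //.
have [dpv dpw dpx] := path_deg pp vw; have [dqv dqw dqx] := path_deg pq vw.
have [->|xv] := pselect (x = v); first by rewrite dpv dqv.
have [->|xw] := pselect (x = w); first by rewrite dpw dqw.
have nb : ~ (nodes_of G (walk_edges p) x /\ nodes_of G (walk_edges q) x).
  by case=> /np xp /nq xq; case: (dn x xp xq).
case: pqx => [px|qx].
- by rewrite dpx ?deg_notin //; [tauto|apply/np].
- by rewrite dqx ?deg_notin //; [tauto|apply/nq].
Qed.

(** Double counting: every edge of a circle is a link with two ends, and every node is on two
    edges. *)
Lemma circle_ncard C : circle G C -> ncard C = ncard (nodes_of G C).
Proof.
case=> Cf _ nh _ d2; apply: (@double_count _ _ (incident G) 2) => //.
  exact: finite_nodes_of.
move=> e Ce; case: (edge_cases e) => [[v /(nh e v Ce)//]|[v [w l]]].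
have -> : [set u | nodes_of G C u /\ incident G e u] = [set v; w].
  apply/seteqP; split=> u; first by case=> _ /(link_incident l).
  by move/(link_incident l) => i; split=> //; exists e.
exact/card_set2/(link_neq l).
Qed.

(** At an inner node touched by [C] the hypothesis puts all path edges into [C], so consecutive
    edges are both in [C] or both outside, and this propagates along the path. *)
Lemma path_all_or_none v p w C : is_path G v p w -> v <> w ->
  (forall x, List.In x (walk_nodes v p) -> x <> v -> x <> w ->
     inc_edges C x !=set0 -> inc_edges (walk_edges p) x `<=` C) ->
  walk_edges p `<=` C \/ walk_edges p `&` C = set0.
Proof.
elim: p v => [|[e a] p IH] v; first by case=> /= ->.
case/is_path_cons=> l pp nv vw Cp.
have [aw|aw] := pselect (a = w).
  subst w; rewrite (path_loop pp) walk_edges_cons walk_edges_nil setU0.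
  have [Ce|nCe] := pselect (C e); first by left=> _ ->.
  by right; rewrite -subset0 => _ [-> ].
have va : v <> a by exact: link_neq l.
have Ca : inc_edges C a !=set0 -> inc_edges (walk_edges ((e, a) :: p)) a `<=` C.
  by apply: Cp => //; [right; left|move/esym].
have ia : incident G e a by apply/(link_incident l); right.
have [f pf fa] : nodes_of G (walk_edges p) a.
  by case: pp => wp _; apply/(nodes_of_walk _ wp aw); left.
rewrite walk_edges_cons in Cp Ca *.
have [|pC|pC] := IH a pp aw.
- move=> x xp xa xw Cx; apply: subset_trans (Cp x _ _ xw Cx).
  + by move=> g [pg gx]; split=> //; right.
  + by right.
  + by move=> xv; subst x.
- left; rewrite subUset; split=> // _ ->; apply: Ca.
    by exists f; split=> //; exact: pC.
  by split=> //; left.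
- right; rewrite -subset0 => g [[->|pg] Cg]; last by rewrite -pC.
  suff : set0 f by [].
  rewrite -pC; split; first exact: pf.
  by apply: Ca; [exists e|split=> //; right].
Qed.

Lemma internally_disjointC v w p q :
  internally_disjoint v w p q -> internally_disjoint v w q p.
Proof. by case=> de dn; split; [rewrite setIC|move=> x xq xp; apply: dn]. Qed.

Lemma circle_deg C x : circle G C -> nodes_of G C x -> deg C x = 2.
Proof. by case=> _ _ _ _ d2 /d2/ncardE. Qed.

Lemma theta_circle_path v w p q r C : v <> w ->
  is_path G v p w -> is_path G v q w -> is_path G v r w ->
  internally_disjoint v w p q -> internally_disjoint v w p r ->
  internally_disjoint v w q r -> circle G C ->
  C `<=` walk_edges p `|` walk_edges q `|` walk_edges r ->
  walk_edges p `<=` C \/ walk_edges p `&` C = set0.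
Proof.
move=> vw pp pq pr [epq dpq] [epr dpr] [eqr dqr] circ CS.
apply: (path_all_or_none pp vw) => x xp xv xw [f [Cf fx]].
have [_ _ dp2] := path_deg pp vw.
have CE : inc_edges C x `<=` inc_edges (walk_edges p) x.
  move=> e [/CS Se ex]; split=> //; case: pq pr => wq _ [wr _].
  case: Se => [[//|qe]|re].
  - have xq : List.In x (walk_nodes v q) by apply: (nodes_of_walk_sub wq); exists e.
    by case: (dpq x xp xq).
  - have xr : List.In x (walk_nodes v r) by apply: (nodes_of_walk_sub wr); exists e.
    by case: (dpr x xp xr).
rewrite -(subset_ncard_eq _ CE); first by move=> e [].
- exact/finite_inc_edges/finite_walk_edges.
- by rewrite -/(deg _ x) dp2 // -/(deg C x) (circle_deg circ) //; exists f.
Qed.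

(** The circle is a union of whole paths, and degree two at [v] allows exactly two: three give
    degree three, one gives degree one, and none leaves the circle empty. *)
Lemma theta_circles v w p q r C : v <> w ->
  is_path G v p w -> is_path G v q w -> is_path G v r w ->
  internally_disjoint v w p q -> internally_disjoint v w p r ->
  internally_disjoint v w q r -> circle G C ->
  C `<=` walk_edges p `|` walk_edges q `|` walk_edges r ->
  [\/ C = walk_edges p `|` walk_edges q, C = walk_edges p `|` walk_edges r
    | C = walk_edges q `|` walk_edges r].
Proof.
move=> vw pp pq pr dpq dpr dqr circ CS.
have dqp := internally_disjointC dpq; have drp := internally_disjointC dpr.
have drq := internally_disjointC dqr.
have hp := theta_circle_path vw pp pq pr dpq dpr dqr circ CS.
have hq : walk_edges q `<=` C \/ walk_edges q `&` C = set0.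
  by apply: (theta_circle_path vw pq pp pr) => //; rewrite (setUC (walk_edges q)).
have hr : walk_edges r `<=` C \/ walk_edges r `&` C = set0.
  apply: (theta_circle_path vw pr pq pp) => //.
  by move=> e /CS[[|]|]; [right|left; right|left; left].
have [dpv _ _] := path_deg pp vw; have [dqv _ _] := path_deg pq vw.
have [drv _ _] := path_deg pr vw.
have pf := finite_walk_edges p; have qf := finite_walk_edges q.
have rf := finite_walk_edges r.
have out X e : X `&` C = set0 -> C e -> ~ X e.
  by move=> XC Ce Xe; have : set0 e by rewrite -XC.
have Cv X : deg X v = 1 -> X `<=` C -> deg C v = 2.
  move=> d1 XC; apply: (circle_deg circ); apply: (nodes_of_sub XC).
  by apply: contrapT => /deg_notin; rewrite d1.
case: dpq dpr dqr => [epq _] [epr _] [eqr _].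
case: hp hq hr => [hp|hp] [hq|hq] [hr|hr].
- have CE : C = walk_edges p `|` walk_edges q `|` walk_edges r.
    by apply/seteqP; split=> // e [[/hp|/hq]|/hr].
  have := Cv _ dpv hp; rewrite CE degU ?degU ?dpv ?dqv ?drv //.
  + by rewrite finite_setU.
  + by rewrite setIUl epr eqr setU0.
- apply: Or31; apply/seteqP; split; last by move=> e [/hp|/hq].
  by move=> e Ce; case: (CS e Ce) => // /(out _ _ hr Ce).
- apply: Or32; apply/seteqP; split; last by move=> e [/hp|/hr].
  by move=> e Ce; case: (CS e Ce) => [[|/(out _ _ hq Ce)//]|]; [left|right].
- have CE : C = walk_edges p.
    apply/seteqP; split=> // e Ce.
    by case: (CS e Ce) => [[//|/(out _ _ hq Ce)//]|/(out _ _ hr Ce)].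
  by have := Cv _ dpv hp; rewrite CE dpv.
- apply: Or33; apply/seteqP; split; last by move=> e [/hq|/hr].
  by move=> e Ce; case: (CS e Ce) => [[/(out _ _ hp Ce)//|]|]; [left|right].
- have CE : C = walk_edges q.
    apply/seteqP; split=> // e Ce.
    by case: (CS e Ce) => [[/(out _ _ hp Ce)//|//]|/(out _ _ hr Ce)].
  by have := Cv _ dqv hq; rewrite CE dqv.
- have CE : C = walk_edges r.
    apply/seteqP; split=> // e Ce.
    by case: (CS e Ce) => [[/(out _ _ hp Ce)//|/(out _ _ hq Ce)]|].
  by have := Cv _ drv hr; rewrite CE drv.
- case: circ => _ [e Ce] _ _ _.
  by case: (CS e Ce) => [[/(out _ _ hp Ce)|/(out _ _ hq Ce)]|/(out _ _ hr Ce)].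
Qed.

(** * Components and the removal of a component *)

Definition link_closed S (X : set N) :=
  forall e a b, S e -> link G e a b -> X a -> X b.

(** Stated for link-closed sets so as to serve a component, its complement and the node set of an
    induced subgraph alike. *)
Lemma joined_within S X v w : link_closed S X -> X v -> joined G S v w ->
  joined G (edges_at G S X) v w /\ X w.
Proof.
move=> cl Xv [p]; elim: p v Xv => [|[e a] p IH] v Xv /=.
  by move=> <- _; split=> //; exact: joined_refl.
case=> l wp; rewrite walk_edges_cons subUset => -[Se pS].
have {}Se : S e by exact: Se.
have Xa : X a by exact: cl l Xv.
have [jaw Xw] := IH a Xa wp pS; split=> //; apply: joined_trans jaw.
apply: (joined_link _ l); split=> //; exists v => //.
by apply/(link_incident l); left.
Qed.

Lemma joined_leaves S X v w : joined G S v w -> X v -> ~ X w ->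
  exists e a b, [/\ S e, link G e a b, X a & ~ X b].
Proof.
move=> j Xv nXw; apply: contrapT => nE; case: nXw.
apply: (proj2 (@joined_within S X v w _ Xv j)) => e a b Se l Xa.
by apply: contrapT => nXb; apply: nE; exists e, a, b.
Qed.

Section Component.
Variables (S : set E) (X : set N).
Hypothesis Xcomp : component G S X.

Lemma component_closed : link_closed S X.
Proof.
case: Xcomp => v Sv -> e a b Se l ja; apply: joined_trans ja _.
exact: joined_link Se l.
Qed.

Lemma componentC_closed : link_closed S (~` X).
Proof.
move=> e a b Se l nXa Xb; apply: nXa.
by apply: (component_closed Se _ Xb); exact: link_sym.
Qed.

Lemma component_nodes : X `<=` nodes_of G S.
Proof. by case: Xcomp => v Sv -> w; exact: joined_nodes. Qed.

Lemma edges_at_closed e x : edges_at G S X e -> incident G e x -> X x.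
Proof.
case=> Se [y Xy] iy ix; case: (edge_cases e) => [[v h]|[v [w l]]].
  by move/(half_incident h): ix => ->; move/(half_incident h): iy => <-.
have cl := component_closed.
move/(link_incident l): ix; move/(link_incident l): iy.
have vw : X v -> X w by exact: cl l.
have wv : X w -> X v by apply: cl (link_sym l).
by case=> ?; subst y; case=> ->; tauto.
Qed.

Lemma nodes_of_edges_at : nodes_of G (edges_at G S X) = X.
Proof.
apply/seteqP; split=> x; first by case=> e Xe; exact: edges_at_closed.
move=> Xx; have [e Se i] := component_nodes Xx.
by exists e => //; split=> //; exists x.
Qed.

Lemma component_connected : connected G (edges_at G S X).
Proof.
move=> a b; rewrite nodes_of_edges_at => Xa Xb.
have [|//] := joined_within component_closed Xa (_ : joined G S a b).
case: Xcomp Xa Xb => v Sv -> ja jb; exact: joined_trans (joined_sym ja) jb.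
Qed.

(** Deleting a component leaves the other components and their edges unchanged; this drives the
    induction in [frame_rank]. *)
Let S' := S `\` edges_at G S X.

Lemma edges_atC_sub : edges_at G S (~` X) `<=` S'.
Proof.
move=> e [Se [x nXx ix]]; split=> // Xe; apply: nXx.
exact: edges_at_closed Xe ix.
Qed.

Lemma rest_nodes : nodes_of G S' = nodes_of G S `\` X.
Proof.
apply/seteqP; split=> x.
  case=> e [Se nXe] i; split; first by exists e.
  by move=> Xx; apply: nXe; split=> //; exists x.
case=> -[e Se i] nXx; exists e => //; apply: edges_atC_sub.
by split=> //; exists x.
Qed.

Lemma rest_joined v w : ~ X v -> joined G S' v w <-> joined G S v w.
Proof.
move=> nXv; split; first by apply: joined_sub => e [].
move=> j; have [j' _] := joined_within componentC_closed nXv j.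
exact: joined_sub edges_atC_sub j'.
Qed.

Lemma component_disjoint Y : component G S Y -> Y <> X -> Y `&` X = set0.
Proof.
move=> [v Sv YE] YX; rewrite -subset0 => z [Yz Xz]; apply: YX.
case: Xcomp => w Sw XE; rewrite XE in Xz *; rewrite YE in Yz *.
apply/seteqP; split=> y jy; rewrite /=.
- exact: joined_trans Xz (joined_trans (joined_sym Yz) jy).
- exact: joined_trans Yz (joined_trans (joined_sym Xz) jy).
Qed.

Lemma rest_component Y : component G S' Y <-> component G S Y /\ Y <> X.
Proof.
split.
- case=> v; rewrite rest_nodes => -[Sv nXv] ->.
  have -> : [set w | joined G S' v w] = [set w | joined G S v w].
    by apply/seteqP; split=> w /(rest_joined _ nXv).
  split; first by exists v.
  by move=> e; apply: nXv; rewrite -e; exact: joined_refl.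
- case=> cY YX; have YX0 := component_disjoint cY YX.
  case: cY => v Sv YE.
  have nXv : ~ X v.
    move=> Xv; have : set0 v by rewrite -YX0; split=> //; rewrite YE; exact: joined_refl.
    by [].
  exists v; first by rewrite rest_nodes.
  by rewrite YE; apply/seteqP; split=> w /(rest_joined _ nXv).
Qed.

Lemma rest_edges_at Y : component G S' Y -> edges_at G S' Y = edges_at G S Y.
Proof.
case/rest_component => cY YX; have YX0 := component_disjoint cY YX.
apply/seteqP; split=> e; first by case=> -[Se _] Ye.
case=> Se [x Yx ix]; split; last by exists x.
apply: edges_atC_sub; split=> //; exists x => // Xx.
have : set0 x by rewrite -YX0.
by [].
Qed.

End Component.
End GraphTheory.

(** * Apical hyperplanes *)

Section Coordinates.
Variables (P : projGeom) (N : Type) (hat : N -> P).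
Hypotheses (hat_inj : injective hat) (hat_basis : point_basis (range hat)).
Implicit Types (X Y : set N) (v w x : N) (p q : P).

(** With the basis as coordinate system, these are the points whose coordinates at [X] vanish; a
    singleton gives a node hyperplane. *)
Definition coord_subspace X : set P := Span (hat @` ~` X).
Local Notation Z := coord_subspace.

Lemma subspace_coord X : subspace (Z X).
Proof. exact: subspace_Span. Qed.

Lemma sub_coord X Y : X `<=` Y -> Z Y `<=` Z X.
Proof. by move=> XY; apply: subset_Span => _ [v nYv <-]; exists v => // /XY. Qed.

Lemma coord_hat X v : Z X (hat v) <-> ~ X v.
Proof.
split; last by move=> nXv; apply: sub_Span; exists v.
move=> Zv Xv; have [ind _] := hat_basis.
apply: (ind (hat v)); first by exists v.
apply: subset_Span Zv => _ [w nXw <-]; split; first by exists w.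
by move=> /hat_inj e; rewrite e in nXw.
Qed.

Lemma hat_full K : subspace K -> (forall v, K (hat v)) -> K = setT.
Proof.
move=> Ks Kv; apply/seteqP; split=> // z _; case: hat_basis => _ T.
have : Span (range hat) z by rewrite T.
by apply: Span_sub => // _ [v _ <-].
Qed.

Lemma coord0 : Z set0 = setT.
Proof. by apply: hat_full; [exact: subspace_coord|move=> v; apply/coord_hat]. Qed.

Lemma node_hyperplaneE v : node_hyperplane hat v = Z [set v].
Proof.
rewrite /node_hyperplane; congr Span; apply/seteqP; split=> z.
  by case=> -[w _ <-] nw; exists w => // e; apply: nw; rewrite e.
by case=> w nw <-; split; [exists w|move=> /hat_inj].
Qed.

Lemma jn_coord X v : ~ X v -> jn (Z (v |` X)) (hat v) = Z X.
Proof.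
move=> nXv; apply/seteqP; split.
  apply: jn_sub; first exact: subspace_coord.
    by apply: sub_coord => x; right.
  exact/coord_hat.
apply: Span_sub; first exact: subspace_jn.
move=> _ [w nXw <-]; have [->|wv] := pselect (w = v); first exact: jn_in.
by apply: sub_jn; apply/coord_hat => -[].
Qed.

Lemma coord_cod X : finite_set X -> cod (ncard X) (Z X).
Proof.
move: X; apply: finite_set_induct => [|v X Xf nXv cX]; first by rewrite ncard0 coord0.
rewrite ncardU1 //; apply: (@cod_jnS _ _ _ (hat v)); last by rewrite jn_coord.
by move/coord_hat; apply; left.
Qed.

(** When [v] is added, [Z X] is the join of a subspace of [Z [set v]] with [hat v]; intersecting
    with [Z [set v]], which misses [hat v], undoes that join. *)
Lemma coord_bigcap X : finite_set X -> \bigcap_(v in X) Z [set v] = Z X.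
Proof.
move: X; apply: finite_set_induct => [|v X Xf nXv IH].
  by rewrite bigcap_set0 coord0.
rewrite bigcap_setU1 IH -(jn_coord nXv); apply/seteqP; split.
  apply: setI_jn_notin; try exact: subspace_coord.
    by apply: sub_coord => x ->; left.
  by move/coord_hat; apply.
move=> z Zz; split; last exact: sub_jn.
by apply: sub_coord Zz => x ->; left.
Qed.

Lemma hyperplane_coord1 v : hyperplane (Z [set v]).
Proof.
split; first exact: subspace_coord.
by have := coord_cod (finite_set1 v); rewrite (ncardE card_set1).
Qed.

Lemma apical_hyperplaneE v w p : ~ range hat p ->
  apical_hyperplane hat v w p = jn (Z [set v; w]) p.
Proof.
move=> np; rewrite /apical_hyperplane asboolF // /jn Span_SpanU; congr Span.
congr setU; apply/seteqP; split=> z.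
  case=> -[x _ <-] nx; exists x => // vw; apply: nx.
  by case: vw => ->; [left|right].
case=> x nx <-; split; first by exists x.
by case=> /hat_inj e; apply: nx; [left|right].
Qed.

Lemma apical_hyperplaneC v w p :
  apical_hyperplane hat v w p = apical_hyperplane hat w v p.
Proof. by rewrite /apical_hyperplane (setUC [set hat v]). Qed.

Lemma coord2_notin v w p : v <> w -> collinear (hat v) (hat w) p ->
  ~ range hat p -> ~ Z [set v; w] p.
Proof.
move=> vw c np Zp; suff : Z [set w] (hat w) by move/coord_hat; apply.
apply: (@subspace_collinear _ _ (hat v) p).
- exact: subspace_coord.
- by apply/coord_hat.
- by apply: sub_coord Zp => x ->; right.
- by move=> e; apply: np; exists v.
- exact: collinearCr.
Qed.

Lemma hyperplane_apical v w p : v <> w -> collinear (hat v) (hat w) p ->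
  ~ range hat p -> hyperplane (apical_hyperplane hat v w p).
Proof.
move=> vw c np; rewrite apical_hyperplaneE //; split; first exact: subspace_jn.
have := coord_cod (finite_set2 v w); rewrite (ncardE (card_set2 vw)) => c2.
have [k [<-] //] := cod_jn (@subspace_coord _) c2 (coord2_notin vw c np).
Qed.

(** Containing both [hat v] and [p], the hyperplane would contain their line, hence [hat w] and the
    whole basis. *)
Lemma apical_end v w p : v <> w -> collinear (hat v) (hat w) p ->
  ~ range hat p -> ~ apical_hyperplane hat v w p (hat v).
Proof.
move=> vw c np Hv; have Hh := hyperplane_apical vw c np.
apply: (hyperplane_neqT Hh); have [Hs _] := Hh.
rewrite apical_hyperplaneE // in Hv Hs *.
apply: hat_full => // x; have [->//|xv] := pselect (x = v).
have [->|xw] := pselect (x = w); last by apply: sub_jn; apply/coord_hat => -[].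
apply: (@subspace_collinear _ _ (hat v) p) => //; first exact: jn_in.
- by move=> e; apply: np; exists v.
- exact: collinearCr.
Qed.

Lemma apical_hat v w p : v <> w -> collinear (hat v) (hat w) p ->
  ~ range hat p ->
  forall x, ~ apical_hyperplane hat v w p (hat x) <-> x = v \/ x = w.
Proof.
move=> vw c np x; split.
  move=> nH; apply: contrapT => nx; apply: nH.
  by rewrite apical_hyperplaneE //; apply: sub_jn; apply/coord_hat => -[|]; tauto.
case=> ->; first exact: apical_end.
rewrite apical_hyperplaneC; apply: apical_end => //; first by move/esym.
exact: collinearC.
Qed.

Section Arrangement.
Variable A : set (set P).
Hypothesis A_apical : A `<=` apical_hyperplanes hat.
Implicit Types (S T C : set A) (e f : A).
Local Notation G := (cevian_graph hat A).

Lemma hyp_in e : A (hyp e).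
Proof. exact: set_mem (valP e). Qed.

Lemma hyp_cases e : (exists v, Defs.half G e v) \/ exists v w, link G e v w.
Proof.
have [v [w [p [vw c HE]]]] := A_apical (hyp_in e).
have [pr|np] := pselect (range hat p); last by right; exists v, w; split=> //; exists p.
left; case: pr => u _ up; exists u; rewrite /= HE /apical_hyperplane asboolT.
  by rewrite /node_hyperplane up.
by exists u.
Qed.

Lemma half_hyp e v : Defs.half G e v -> hyp e = Z [set v].
Proof. by rewrite /= node_hyperplaneE. Qed.

Lemma half_hat e v : Defs.half G e v -> forall x, ~ hyp e (hat x) <-> x = v.
Proof.
move/half_hyp=> -> x; split; last by move=> -> /coord_hat; apply.
by move=> nZ; apply: contrapT => xv; apply/nZ/coord_hat.
Qed.

Lemma link_hat e v w : link G e v w -> forall x, ~ hyp e (hat x) <-> x = v \/ x = w.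
Proof. by case=> vw [p [c np ->]]; exact: apical_hat. Qed.

Lemma hyp_hyperplane e : hyperplane (hyp e).
Proof.
case: (hyp_cases e) => [[v /half_hyp ->]|[v [w [vw [p [c np ->]]]]]].
  exact: hyperplane_coord1.
exact: hyperplane_apical.
Qed.

(** The hyperplane alone determines the kind and ends of its edge: the ends are the nodes whose
    basis points it misses, one for a half edge and two for a link. *)
Lemma cevian_is_graph : is_graph G.
Proof.
have lsym e v w : link G e v w -> link G e w v.
  case=> vw [p [c np HE]]; split; first by move/esym.
  by exists p; split=> //; [exact: collinearC|rewrite apical_hyperplaneC].
move=> e; case: (hyp_cases e) => [[v h]|[v [w l]]]; [left; exists v|right; exists v, w].
  split=> [x|x y l].
    split=> [hx|-> //]; apply/(half_hat h); apply/(half_hat hx) => //.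
  case: (l) => xy _; apply: xy.
  have /(half_hat h) -> : ~ hyp e (hat x) by apply/(link_hat l); left.
  by have /(half_hat h) -> : ~ hyp e (hat y) by apply/(link_hat l); right.
have [vw _] := l; split=> // [x h|x y].
  have /(half_hat h) e1 : ~ hyp e (hat v) by apply/(link_hat l); left.
  have /(half_hat h) e2 : ~ hyp e (hat w) by apply/(link_hat l); right.
  by apply: vw; rewrite e1 e2.
split; last by case=> -[-> ->] //; exact: lsym.
move=> lxy; have [xy _] := lxy.
have /(link_hat l) ex : ~ hyp e (hat x) by apply/(link_hat lxy); left.
have /(link_hat l) ey : ~ hyp e (hat y) by apply/(link_hat lxy); right.
by case: ex ey => -> [] -> in xy *; [|left|right|].
Qed.

Local Notation graphP := cevian_is_graph.

Lemma incident_hat e x : incident G e x <-> ~ hyp e (hat x).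
Proof.
case: (hyp_cases e) => [[v h]|[v [w l]]].
  split; first by move/(half_incident graphP h)/(half_hat h).
  by move/(half_hat h)/(half_incident graphP h).
split; first by move/(link_incident graphP l)/(link_hat l).
by move/(link_hat l)/(link_incident graphP l).
Qed.

(** * Potentials *)

Definition meet S : set P := \bigcap_(e in S) hyp e.

(* Plays the role of a switching function: a point of the flat of S with no
   zero coordinate at the nodes of X. *)
Definition potential X S q := meet S q /\ forall v, X v -> ~ Z [set v] q.

Lemma subspace_meet S : subspace (meet S).
Proof. by apply: subspace_bigcap => e _; case: (hyp_hyperplane e). Qed.

Lemma meet_sub S T : S `<=` T -> meet T `<=` meet S.
Proof. by move=> ST q Tq e /ST; exact: Tq. Qed.

Lemma meetU S T : meet (S `|` T) = meet S `&` meet T.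
Proof. exact: bigcap_setU. Qed.

Lemma potential_sub X Y S T q : Y `<=` X -> T `<=` S -> potential X S q ->
  potential Y T q.
Proof.
by move=> YX TS [Sq Xq]; split; [exact: meet_sub Sq|move=> v /YX; exact: Xq].
Qed.

Lemma meet_hat S v : ~ nodes_of G S v -> meet S (hat v).
Proof.
move=> nv e Se; apply: contrapT => /incident_hat i; apply: nv; by exists e.
Qed.

Lemma coord_sub_meet S : Z (nodes_of G S) `<=` meet S.
Proof.
by apply: Span_sub => [|_ [v nv <-]]; [exact: subspace_meet|exact: meet_hat].
Qed.

(** The hyperplane of [e] contains the coordinate subspace of [v] and [w] but not [hat w], while [Z
    [set v]] is the join of that subspace with [hat w]. So a point of both has zero coordinate at
    [w] too. *)
Lemma link_transfer e v w q : link G e v w -> hyp e q -> Z [set v] q -> Z [set w] q.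
Proof.
move=> l eq vq; have [vw _] := l; have [es _] := hyp_hyperplane e.
have nw : ~ [set v] w by move=> /esym.
suff Zq : Z (w |` [set v]) q by apply: sub_coord Zq => x ->; left.
apply: (@setI_jn_notin _ (hyp e) _ (hat w)) => //.
- exact: subspace_coord.
- apply: Span_sub => // _ [x nx <-]; apply: contrapT => /(link_hat l).
  by case=> ex; apply: nx; [right|left].
- by apply/(link_hat l); right.
- by split=> //; rewrite (jn_coord nw).
Qed.

Lemma joined_transfer S v w q : joined G S v w -> meet S q -> Z [set v] q ->
  Z [set w] q.
Proof.
move=> [p + pS] Sq; elim: p v pS => [|[e a] p IH] v /=; first by move=> _ ->.
rewrite walk_edges_cons subUset => -[Se pS] [l wp] vq.
by apply: (IH a) => //; apply: (link_transfer l) => //; apply/Sq/Se.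
Qed.

Section ConnectedFlat.
Variable S : set A.
Hypotheses (Sconn : connected G S) (Xfin : finite_set (nodes_of G S)).
Local Notation X := (nodes_of G S).

Lemma potential_of_support q v : meet S q -> X v -> ~ Z [set v] q ->
  potential X S q.
Proof.
move=> Sq Xv vq; split=> // w Xw wq; apply: vq.
exact: joined_transfer (Sconn Xw Xv) Sq wq.
Qed.

Lemma meet_unbalanced : ~ (exists q, potential X S q) -> meet S = Z X.
Proof.
move=> npot; apply/seteqP; split; last exact: coord_sub_meet.
move=> q Sq; rewrite -coord_bigcap // => v Xv; apply: contrapT => vq.
by apply: npot; exists q; exact: potential_of_support Xv vq.
Qed.

(** By connectedness, one vanishing coordinate on [X] forces all the others to vanish. *)
Lemma meetI_coord v : X v -> meet S `&` Z [set v] = Z X.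
Proof.
move=> Xv; apply/seteqP; split=> q.
  case=> Sq vq; rewrite -coord_bigcap // => w Xw.
  exact: joined_transfer (Sconn Xv Xw) Sq vq.
by move=> Zq; split; [exact: coord_sub_meet|apply: sub_coord Zq => x ->].
Qed.

(** Joining [q] to the node hyperplane of [v] gives the whole space, so the modular law presents the
    flat as the join of [q] with its intersection with that hyperplane. *)
Lemma meet_balanced q : X !=set0 -> potential X S q -> meet S = jn (Z X) q.
Proof.
case=> v Xv [Sq /(_ v Xv) vq]; rewrite -(meetI_coord Xv) -setI_jn //.
- by rewrite jn_hyperplane ?setIT //; exact: hyperplane_coord1.
- exact: subspace_meet.
- exact: subspace_coord.
Qed.

Lemma cod_meet_unbalanced : ~ (exists q, potential X S q) -> cod (ncard X) (meet S).
Proof. by move/meet_unbalanced ->; exact: coord_cod. Qed.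

Lemma cod_meet_balanced : X !=set0 -> (exists q, potential X S q) ->
  exists2 n, ncard X = n.+1 & cod n (meet S).
Proof.
move=> X0 [q pq]; rewrite (meet_balanced X0 pq).
apply: cod_jn; [exact: subspace_coord|exact: coord_cod|].
case: X0 => v Xv; case: pq => _ /(_ v Xv) vq Zq; apply: vq.
by apply: sub_coord Zq => x ->.
Qed.

(** This closes up circles: the hyperplane of an edge with all ends in [X] already contains [Z X],
    so a single potential decides whether it contains the flat. *)
Lemma meet_sub_hyp f q : X !=set0 -> potential X S q -> hyp f q ->
  (forall x, incident G f x -> X x) -> meet S `<=` hyp f.
Proof.
move=> X0 pq fq fX; have [fs _] := hyp_hyperplane f.
rewrite (meet_balanced X0 pq); apply: jn_sub => //; apply: Span_sub => //.
by move=> _ [v nv <-]; apply: contrapT => /incident_hat /fX.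
Qed.

End ConnectedFlat.

Lemma circle_nodes C : circle G C -> finite_set (nodes_of G C) /\ nodes_of G C !=set0.
Proof.
case=> Cf C0 _ _ _; split; first exact: (finite_nodes_of graphP).
exact: (nodes_of_neq0 graphP).
Qed.

Lemma balanced_circleP C : circle G C ->
  balanced_circles (Omega hat A) C <-> exists q, potential (nodes_of G C) C q.
Proof.
move=> Cc; have [Xf X0] := circle_nodes Cc; have [_ _ _ Cconn _] := Cc.
have Cs := @subspace_meet C; rewrite /= /rkP (circle_ncard graphP Cc).
split=> [[_]|pot].
  move=> lt; apply: contrapT => /(cod_meet_unbalanced Cconn Xf) c.
  by move: lt; rewrite (codimE Cs c) ltnn.
have [n Xn c] := cod_meet_balanced Cconn Xf X0 pot.
by split=> //; rewrite Xn (codimE Cs c).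
Qed.

Lemma potential_balanced S q : potential (nodes_of G S) S q ->
  balanced (Omega hat A) S.
Proof.
move=> pq; split=> [e v Se h|C Cc CS].
  case: pq => Sq /(_ v); apply; first by exists e => //; left.
  by rewrite -(half_hyp h); exact: Sq.
apply/(balanced_circleP Cc); exists q; apply: potential_sub pq => //.
exact: nodes_of_sub.
Qed.

(** Projecting [q] from [hat w] into the hyperplane of [e] changes only the coordinate at [w]: the
    edges of [S] avoid [w], so the point stays in their flat, and its coordinates on [X] stay
    nonzero. Then [link_transfer] along [e] makes the coordinate at [w] nonzero. *)
Lemma potential_grow X S q e a w : (forall f x, S f -> incident G f x -> X x) ->
  X a -> ~ X w -> link G e a w -> potential X S q ->
  exists q', potential (w |` X) (e |` S) q'.
Proof.
move=> SX Xa nXw l [Sq Xq]; have eh := hyp_hyperplane e.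
have [es _] := eh.
suff [q' [eq' Sq' Xq']] : exists q', [/\ hyp e q', meet S q' &
    forall v, X v -> ~ Z [set v] q'].
  exists q'; split; first by move=> f [->|Sf] //; exact: Sq'.
  move=> v [->|Xv]; last exact: Xq'.
  by move=> /(link_transfer (link_sym graphP l) eq'); exact: Xq'.
have [eq|neq] := pselect (hyp e q); first by exists q.
have new : ~ hyp e (hat w) by apply/(link_hat l); right.
have wv v : X v -> Z [set v] (hat w).
  by move=> Xv; apply/coord_hat => ewv; apply: nXw; rewrite ewv.
have nqw : q <> hat w by move=> e1; apply: (Xq a Xa); rewrite e1; exact: wv.
have [q' eq' c] : exists2 q', hyp e q' & collinear (hat w) q' q.
  have : jn (hyp e) (hat w) q by rewrite jn_hyperplane.
  by case/(jnP es new).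
have nq' : hat w <> q' by move=> e1; apply: new; rewrite e1.
exists q'; split=> //.
  move=> f Sf; have [fs _] := hyp_hyperplane f.
  apply: (@subspace_collinear _ _ (hat w) q) => //.
  - by apply: contrapT => /incident_hat /(SX f w Sf).
  - exact: Sq.
  - by move/esym.
  - exact: collinearCr.
move=> v Xv vq'; apply: (Xq v Xv).
apply: (@subspace_collinear _ _ (hat w) q') => //; first exact: subspace_coord.
exact: wv.
Qed.

Definition induced S X : set A := [set e | S e /\ forall x, incident G e x -> X x].

Lemma link_closed_induced S X : link_closed G (induced S X) X.
Proof.
move=> e a b [_ eX] l _; apply: eX; by apply/(link_incident graphP l); right.
Qed.

(** The potential is extended along one chosen link [e] to [w]. Any other edge [f] from [w] back to
    [X] closes a circle with [e] and a path inside [X]. Since this circle is balanced, [hyp f]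
    contains the flat of the rest of the circle, and with it the new potential. *)
Lemma potential_induced_grow S X w : balanced (Omega hat A) S ->
  (forall a b, X a -> X b -> joined G (induced S X) a b) ->
  (exists q, potential X (induced S X) q) ->
  (exists e a, [/\ S e, link G e a w & X a]) -> ~ X w ->
  exists q, potential (w |` X) (induced S (w |` X)) q.
Proof.
move=> [nhalf bal] Xj [q pq] [e [a [Se l Xa]]] nXw.
have [q' [Sq' Xq']] : exists q', potential (w |` X) (e |` induced S X) q'.
  by apply: potential_grow Xa nXw l pq => f x [_ fX] /fX.
exists q'; split=> // f [Sf fX].
have [fiX|fnX] := pselect (induced S X f); first by apply: Sq'; right.
have [->|fe] := pselect (f = e); first by apply: Sq'; left.
have fw : incident G f w.
  apply: contrapT => nfw; apply: fnX; split=> // x ix.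
  by case: (fX x ix) => // ex; rewrite ex in ix.
have [b lf] : exists b, link G f w b by case: fw => [/(nhalf _ _ Sf)|].
have wb : w <> b by exact: (link_neq graphP lf).
have Xb : X b.
  case: (fX b) => [|/esym//|//].
  by apply/(link_incident graphP lf); right.
(* When [b = a] this path is empty, and [e] and [f] form a circle of two parallel links. *)
have [p pp pX] := joined_path (Xj a b Xa Xb).
have [wp _] := pp.
have pnX x : List.In x (walk_nodes a p) -> X x.
  move/(walk_nodes_joined wp)/(joined_sub pX).
  by case/(joined_within graphP (@link_closed_induced S X) Xa).
have pe : is_path G w ((e, a) :: p) b.
  apply/is_path_cons; split=> //; first exact: (link_sym graphP l).
  by move=> /pnX.
have pf : is_path G w [:: (f, b)] b.
  by apply/is_path_cons; split=> [//||[/esym|]//]; split=> //; repeat constructor.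
have disj : internally_disjoint w b ((e, a) :: p) [:: (f, b)].
  split; last by move=> x _ [<-|[/= <-|//]]; [left|right].
  rewrite -subset0 walk_edges_cons => g [ge] [/= fg|//]; subst g.
  by case: ge => [|/pX].
have circ := circle_paths graphP wb pe pf disj.
set C := walk_edges _ `|` _ in circ.
have CS : C `<=` S.
  move=> g [|[<-|]//]; rewrite walk_edges_cons.
  by case=> [->|/pX[]].
have [qC pqC] : exists q, potential (nodes_of G C) C q.
  exact/(balanced_circleP circ)/bal.
(* [T] is the circle without [f]: a path joining the ends of [f], to which [meet_sub_hyp] applies
   with the potential of the circle. *)
set T := walk_edges ((e, a) :: p) in C circ CS pqC.
have TC : T `<=` C by move=> g; left.
have wT := pe.1.
have Tw : nodes_of G T w by apply/(nodes_of_walk graphP _ wT wb); left.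
apply: (@meet_sub_hyp T _ _ f qC).
- exact: (connected_walk graphP wT).
- exact/(finite_nodes_of graphP)/finite_walk_edges.
- by exists w.
- apply: potential_sub pqC => //; exact: nodes_of_sub.
- by case: pqC => + _; apply; right; left.
- move=> x /(link_incident graphP lf)[->//|->].
  exact/(nodes_of_walk graphP _ wT wb)/(walk_nodes_last wT).
- apply: meet_sub Sq'; rewrite /T walk_edges_cons => g [->|/pX]; by [left|right].
Qed.

(** Starting from one node, adjacent nodes are added until all are reached. The edges considered are
    those induced on the current node set, which stays joined within them; the induction is on the
    number of missing nodes. *)
Lemma balanced_potential S : S !=set0 -> connected G S ->
  finite_set (nodes_of G S) -> balanced (Omega hat A) S ->
  exists q, potential (nodes_of G S) S q.
Proof.
move=> /(nodes_of_neq0 graphP)[v0 Xv0] Sconn Xf bal.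
suff [q pq] : exists q, potential (nodes_of G S) (induced S (nodes_of G S)) q.
  by exists q; apply: potential_sub pq => // e Se; split=> // x ix; exists e.
have grow k X : ncard (nodes_of G S `\` X) = k -> X v0 -> X `<=` nodes_of G S ->
    (forall a b, X a -> X b -> joined G (induced S X) a b) ->
    (exists q, potential X (induced S X) q) ->
    exists q, potential (nodes_of G S) (induced S (nodes_of G S)) q.
  elim: k X => [|k IH] X Xk Xv XS Xj pot.
    suff <- : X = nodes_of G S by [].
    apply/seteqP; split=> // x Sx; apply: contrapT => nXx.
    suff : (0 < ncard (nodes_of G S `\` X))%N by rewrite Xk.
    by apply: ncard_gt0; [exact: finite_setD|exists x].
  have [u [Su nXu]] : nodes_of G S `\` X !=set0.
    by apply/set0P/eqP => e; rewrite e ncard0 in Xk.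
  have [e [a [w [Se l Xa nXw]]]] := joined_leaves graphP (Sconn _ _ Xv0 Su) Xv nXu.
  have Sw : nodes_of G S w.
    by exists e => //; apply/(link_incident graphP l); right.
  have iS : induced S X `<=` induced S (w |` X).
    by move=> f [Sf fX]; split=> // x /fX; right.
  have ja b : (w |` X) b -> joined G (induced S (w |` X)) b a.
    case=> [->|Xb]; last exact: joined_sub (Xj b a Xb Xa).
    apply: (@joined_link _ _ _ _ e); last exact: (link_sym graphP l).
    by split=> // x /(link_incident graphP l)[->|->]; [right|left].
  apply: (IH (w |` X)).
  - have wS : [set w] `<=` nodes_of G S `\` X by move=> _ ->.
    have := ncard_setD (finite_setD X Xf) (finite_set1 w) wS.
    rewrite Xk (ncardE card_set1) add1n => -[->].
    congr ncard; apply/seteqP; split=> z; rewrite /=; tauto.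
  - by right.
  - by move=> x [->|/XS].
  - move=> b c /ja jb /ja jc.
    exact: joined_trans jb (joined_sym graphP jc).
  - by apply: potential_induced_grow => //; exists e, a.
apply: (grow _ [set v0] erefl) => //.
- by move=> x ->.
- by move=> a b -> ->; exact: joined_refl.
(* No edge is induced on a single node, as balance excludes half edges and links have two ends; only
   the coordinate at [v0] has to be checked. *)
exists (hat v0); split; last by move=> v -> /coord_hat; apply.
move=> e [Se ev]; case: bal => nh _.
case: (hyp_cases e) => [[v /(nh e v Se)//]|[v [w l]]].
have vv : v = v0 by apply: ev; apply/(link_incident graphP l); left.
have wv : w = v0 by apply: ev; apply/(link_incident graphP l); right.
by case: (link_neq graphP l); rewrite vv wv.
Qed.

Lemma balancedP S : S !=set0 -> connected G S -> finite_set (nodes_of G S) ->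
  balanced (Omega hat A) S <-> exists q, potential (nodes_of G S) S q.
Proof.
move=> S0 Sc Xf; split; first exact: balanced_potential.
by case=> q; exact: potential_balanced.
Qed.

(** * The frame matroid *)

(** Without a potential, the flat of the theta would have codimension its number of nodes. The flats
    of the two circles have codimension one less than theirs, and their span lies in the flat of the
    shared path [p], which falls short by only one in all; modularity then contradicts the node
    count. *)
Lemma potential_theta v w (p q r : seq (A * N)) : v <> w ->
  is_path G v p w -> is_path G v q w -> is_path G v r w ->
  internally_disjoint v w p q -> internally_disjoint v w p r ->
  internally_disjoint v w q r ->
  balanced_circles (Omega hat A) (walk_edges p `|` walk_edges q) ->
  balanced_circles (Omega hat A) (walk_edges p `|` walk_edges r) ->
  exists z, potential (nodes_of G (walk_edges p `|` walk_edges q `|` walk_edges r))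
    (walk_edges p `|` walk_edges q `|` walk_edges r) z.
Proof.
move=> vw pp pq pr dpq dpr dqr b1 b2.
set C1 := walk_edges p `|` walk_edges q; set C2 := walk_edges p `|` walk_edges r.
have c1 : circle G C1 by case: b1.
have c2 : circle G C2 by case: b2.
move/(balanced_circleP c1): b1 => pot1; move/(balanced_circleP c2): b2 => pot2.
have [wp _] := pp; have [wq _] := pq; have [wr _] := pr.
have np x := @nodes_of_walk _ _ _ graphP v p w x wp vw.
have nq x := @nodes_of_walk _ _ _ graphP v q w x wq vw.
have nr x := @nodes_of_walk _ _ _ graphP v r w x wr vw.
set S := C1 `|` walk_edges r; have SE : S = C1 `|` C2.
  by rewrite /S /C1 /C2; apply/seteqP; split=> e /=; tauto.
have [f1 n1] := circle_nodes c1; have [f2 n2] := circle_nodes c2.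
have [_ _ _ k1 _] := c1; have [_ _ _ k2 _] := c2.
have pv : nodes_of G (walk_edges p) v by apply/np; left.
have fS : finite_set (nodes_of G S) by rewrite SE nodes_ofU finite_setU.
have fp : finite_set (nodes_of G (walk_edges p)).
  exact/(finite_nodes_of graphP)/finite_walk_edges.
have kS : connected G S.
  by rewrite SE; apply: (@connectedU _ _ _ graphP _ _ v) => //;
    rewrite nodes_ofU; left.
apply: contrapT => /(cod_meet_unbalanced kS fS) cS.
have [m1 e1 cm1] := cod_meet_balanced k1 f1 n1 pot1.
have [m2 e2 cm2] := cod_meet_balanced k2 f2 n2 pot2.
have potp : exists z, potential (nodes_of G (walk_edges p)) (walk_edges p) z.
  case: pot1 => z pz; exists z; apply: potential_sub pz => [|e]; last by left.
  by apply: nodes_of_sub => e; left.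
have [m ep cm] := cod_meet_balanced (connected_walk graphP wp) fp
  (ex_intro _ v pv) potp.
have [s1 s2] := (@subspace_meet C1, @subspace_meet C2).
have [a [b [ca cb ab]]] := cod_modular s1 s2 cm1 cm2.
rewrite -meetU -SE in ca.
have ea := cod_uniq (@subspace_meet S) ca cS.
have [|k [kb ck _]] := cod_sub (@subspace_Span _ _) (@subspace_meet (walk_edges p)) _ cb.
  apply: Span_sub; first exact: subspace_meet.
  by rewrite subUset; split; apply: meet_sub => e; left.
have ek := cod_uniq (@subspace_meet _) ck cm.
have := ncardUI f1 f2; rewrite -nodes_ofU -SE.
(* The circles share exactly the nodes of [p], since [q] and [r] meet only in [v] and [w]. *)
suff -> : nodes_of G C1 `&` nodes_of G C2 = nodes_of G (walk_edges p) by lia.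
rewrite !nodes_ofU -setUIr; apply/seteqP; split; last by move=> x; left.
move=> x [//|[/nq xq /nr xr]]; apply/np.
by case: dqr => _ /(_ x xq xr)[->|->]; [left|exact: walk_nodes_last wp].
Qed.

(** Two balanced circles give the whole theta a potential, which balances the third. The three
    circles are distinct because the paths are nonempty and edge-disjoint. *)
Lemma Omega_theta S : theta G S ->
  ~ ([set C | balanced_circles (Omega hat A) C /\ C `<=` S] #= `I_2).
Proof.
case=> v [w [p [q [r [vw [pp pq pr] [dpq dpr dqr] ->]]]]] B2.
set B := [set C | _] in B2; set S' := _ `|` _ `|` _ in B B2.
have dqp := internally_disjointC dpq; have drp := internally_disjointC dpr.
have drq := internally_disjointC dqr.
set C1 := walk_edges p `|` walk_edges q; set C2 := walk_edges p `|` walk_edges r.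
set C3 := walk_edges q `|` walk_edges r.
have cls C : B C -> [\/ C = C1, C = C2 | C = C3].
  by case=> -[Cc _] CS; apply: (theta_circles graphP vw pp pq pr).
suff [z pz] : exists z, potential (nodes_of G S') S' z.
  have BC C : circle G C -> C `<=` S' -> B C.
    move=> Cc CS; split=> //; apply/(balanced_circleP Cc); exists z.
    by apply: potential_sub pz => //; exact: nodes_of_sub.
  have B1 : B C1.
    apply: BC => [|e Ce]; last by left.
    exact: (circle_paths graphP vw pp pq dpq).
  have B2' : B C2.
    apply: BC => [|e [pe|re]]; [|by left; left|by right].
    exact: (circle_paths graphP vw pp pr dpr).
  have B3 : B C3.
    apply: BC => [|e [qe|re]]; [|by left; right|by right].
    exact: (circle_paths graphP vw pq pr dqr).
  have inp (x : seq (A * N)) : walk_edges x = set0 -> is_path G v x w -> False.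
    case: x => [_ [/= ]//|[e a] x] xe _.
    by have : set0 e by rewrite -xe; left.
  have sub (X Y : set A) (x : seq (A * N)) :
      X `&` Y = set0 -> Y `<=` X -> walk_edges x = Y -> is_path G v x w -> False.
    by move=> XY YX ex; apply: inp; rewrite ex -XY setIidr.
  case: dpq dpr dqr => [epq _] [epr _] [eqr _].
  have n12 : C1 <> C2.
    move=> e12; apply: (sub C1 (walk_edges r) r) => //.
      by rewrite setIUl epr eqr setU0.
    by rewrite e12 => e; right.
  have n13 : C1 <> C3.
    move=> e13; apply: (sub C1 (walk_edges r) r) => //.
      by rewrite setIUl epr eqr setU0.
    by rewrite e13 => e; right.
  have n23 : C2 <> C3.
    move=> e23; apply: (sub C2 (walk_edges q) q) => //.
      by rewrite setIUl epq setIC eqr setU0.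
    by rewrite e23 => e; left.
  have c3 : ncard (C3 |` [set C1; C2]) = 3.
    by rewrite ncardU1 ?(ncardE (card_set2 n12)) // => -[] /esym.
  have Bf : finite_set B by apply/finite_setP; exists 2.
  have := @subset_ncard _ (C3 |` [set C1; C2]) B Bf.
  rewrite c3 (ncardE B2) => H.
  by have : (3 <= 2)%N by apply: H => C [->|[->|->]].
have [D1 [D2 [nD BD1 BD2]]] : exists D1 D2, [/\ D1 <> D2, B D1 & B D2].
  case/eq_cardSP: B2 => D1 B1 /eq_cardSP[D2 [B2 n21] _].
  by exists D1, D2; split=> // /esym.
(* [potential_theta] takes the shared path first, so the theta is rewritten with [q] or [r] in
   front. *)
have S231 : walk_edges q `|` walk_edges p `|` walk_edges r = S'.
  by rewrite /S' (setUC (walk_edges q)).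
have S312 : walk_edges r `|` walk_edges p `|` walk_edges q = S'.
  by rewrite /S' (setUC (walk_edges r)) -!setUA (setUC (walk_edges r)).
have [c12 c13 c23] : [/\ B C1 -> B C2 -> exists z, potential (nodes_of G S') S' z,
    B C1 -> B C3 -> exists z, potential (nodes_of G S') S' z
  & B C2 -> B C3 -> exists z, potential (nodes_of G S') S' z].
  split=> -[b _] [b' _].
  - exact: (potential_theta vw pp pq pr).
  - rewrite -S231; apply: (potential_theta vw pq pp pr) => //.
    by rewrite setUC.
  - rewrite -S312; apply: (potential_theta vw pr pp pq) => //; rewrite setUC //.
by case: (cls _ BD1) (cls _ BD2) => ? [] ?; subst D1 D2; rewrite // in nD *; auto.
Qed.

Lemma Omega_biased : is_biased_graph (Omega hat A).
Proof. by split; [exact: graphP|move=> C []|exact: Omega_theta]. Qed.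

Lemma finite_balanced_components S : finite_set S ->
  finite_set [set X | component G S X /\ balanced (Omega hat A) (edges_at G S X)].
Proof.
move=> Sf; apply: sub_finite_set (finite_image (fun v => [set w | joined G S v w])
  (finite_nodes_of graphP Sf)) => X [[v Sv ->] _].
by exists v.
Qed.

(* Distinct components have disjoint node sets, so their flats together span
   the whole space and codimension is additive over components. *)
Lemma frame_rank S : finite_set S -> exists2 n, cod n (meet S) &
  (n + num_balanced_components (Omega hat A) S = ncard (nodes_of G S))%N.
Proof.
(* Strong induction on the number of edges, splitting off the component of one node. *)
move=> Sf; have [k] := ubnP (ncard S); elim: k S Sf => // k IH S Sf ltS.
have [->|/set0P S0] := eqVneq S set0.
  exists 0; first by rewrite /= /meet bigcap_set0.
  rewrite nodes_of0 ncard0 /num_balanced_components.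
  rewrite (_ : [set X | _] = set0) ?ncard0 // -subset0 => X [[v]].
  by rewrite nodes_of0.
have [v Sv] := nodes_of_neq0 graphP S0.
pose X := [set w | joined G S v w]; have cX : component G S X by exists v.
set S1 := edges_at G S X; pose S' := S `\` S1.
have S1S : S1 `<=` S by move=> e [].
have f1 : finite_set S1 by exact: sub_finite_set S1S Sf.
have f' : finite_set S' by exact: finite_setD.
have n1 : nodes_of G S1 = X := nodes_of_edges_at graphP cX.
have n' : nodes_of G S' = nodes_of G S `\` X := rest_nodes graphP cX.
have Xv : X v by exact: joined_refl.
have S10 : S1 !=set0 by case: Sv => e Se i; exists e; split=> //; exists v.
have Xf : finite_set X by rewrite -n1; exact: (finite_nodes_of graphP).
have XS : X `<=` nodes_of G S := component_nodes graphP cX.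
have [n c' b'] : exists2 n, cod n (meet S') &
    (n + num_balanced_components (Omega hat A) S' = ncard (nodes_of G S'))%N.
  apply: IH => //; have := ncard_setD Sf f1 S1S; have := ncard_gt0 f1 S10.
  by rewrite -/S' => ? ?; lia.
have k1 : connected G S1 := component_connected graphP cX.
(* Basis points of nodes in [X] lie in the flat of [S'], all others in the flat of [S1]. *)
have span : Span (meet S1 `|` meet S') = setT.
  apply: hat_full => [|x]; first exact: subspace_Span.
  apply: sub_Span; have [Xx|nXx] := pselect (X x); [right|left]; apply: meet_hat.
    by rewrite n' => -[].
  by rewrite n1.
have SE : meet S = meet S1 `&` meet S' by rewrite -meetU setDUK.
have cS m : cod m (meet S1) -> cod (m + n) (meet S).
  move=> cm; have [a [b [ca cb <-]]] :=
    cod_modular (@subspace_meet S1) (@subspace_meet S') cm c'.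
  rewrite span in cb; have := cod_uniq (@subspaceT P) cb (erefl : cod 0 setT).
  by move=> ->; rewrite addn0 SE.
have nX : ncard (nodes_of G S) = ncard X + ncard (nodes_of G S').
  by rewrite n' -ncard_setD //; exact: (finite_nodes_of graphP).
rewrite nX -b'; set B' := [set Y | component G S' Y /\
  balanced (Omega hat A) (edges_at G S' Y)].
have nB'X : ~ B' X by case=> /(rest_component graphP cX)[].
have BE Y : component G S Y /\ balanced (Omega hat A) (edges_at G S Y) <->
    B' Y \/ Y = X /\ balanced (Omega hat A) S1.
  split.
    case=> cY bY; have [YX|YX] := pselect (Y = X); first by right; subst Y.
    have cY' : component G S' Y by apply/(rest_component graphP cX).
    by left; split=> //; rewrite (rest_edges_at graphP cX cY').
  case=> [[cY bY]|[-> bX]] //; split; first by case/(rest_component graphP cX): cY.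
  by rewrite -(rest_edges_at graphP cX cY).
have f1n : finite_set (nodes_of G S1) by rewrite n1.
have [bal|unbal] := pselect (balanced (Omega hat A) S1).
  have [||m] := @cod_meet_balanced S1 k1 f1n; first by rewrite n1; exists v.
    exact: balanced_potential.
  rewrite n1 => Xm cm; exists (m + n); first exact: cS.
  rewrite /num_balanced_components (_ : [set Y | _] = X |` B').
    by rewrite ncardU1 //; [rewrite Xm -/B'; lia|exact: finite_balanced_components].
  by apply/seteqP; split=> Y; [case/BE => [|[]]; by [right|left]|
    case=> [->|B'Y]; apply/BE; by [right|left]].
have cm : cod (ncard X) (meet S1).
  rewrite -n1; apply: cod_meet_unbalanced => // pot; apply: unbal.
  exact/balancedP.
exists (ncard X + n); first exact: cS.
rewrite /num_balanced_components (_ : [set Y | _] = B') ?addnA //.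
by apply/seteqP; split=> Y; [case/BE => // -[]|move=> B'Y; apply/BE; left].
Qed.

(** * Matroid isomorphism, closed sets and intersection flats *)

Local Notation FM := (frame_matroid (Omega hat A)).

Lemma frame_rankE S : finite_set S -> rank FM S = codim (meet S).
Proof.
move=> Sf; have [n cn e] := frame_rank Sf.
by rewrite /= -e addnK (codimE (@subspace_meet S) cn).
Qed.

Lemma frame_matroid_iso : matroid_iso (@hyp P A) FM (arrangement_matroid A).
Proof.
have Ah H : A H -> hyperplane H.
  move=> AH; have [H' <-] : exists e : A, hyp e = H.
    by exists (SigSub (mem_set AH)).
  exact: hyp_hyperplane.
split.
- move=> S U Sf Uf _ _.
  have [||r1 r2 r3] := @codim_bigcap_matroid P A (@hyp P A) S U Sf Uf.
  + by move=> e _; exact: hyp_hyperplane.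
  + by move=> e _; exact: hyp_hyperplane.
  rewrite !frame_rankE //; first exact: finite_setIl.
  by rewrite finite_setU.
- move=> S U Sf Uf SA UA; apply: codim_bigcap_matroid => // H; first by move/SA/Ah.
  by move/UA/Ah.
- split.
  + by move=> e _; exact: hyp_in.
  + by move=> e f _ _ /val_inj.
  + by move=> H AH; exists (SigSub (mem_set AH)).
- by move=> S Sf _; rewrite frame_rankE //= bigcap_image.
Qed.

(** Adding [e] keeps the rank exactly when it keeps the flat, because nested flats of equal finite
    codimension coincide. *)
Lemma closureP (F : set A) e : Defs.closure FM F e <->
  exists T, [/\ finite_set T, T `<=` F & meet T `<=` hyp e].
Proof.
have U1 T : meet (e |` T) = hyp e `&` meet T by rewrite meetU /meet bigcap_set1.
split=> [[_ [T [Tf TF]]]|[T [Tf TF Te]]].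
  have eTf : finite_set (e |` T) by rewrite finite_setU; split=> //; exact: finite_set1.
  rewrite !frame_rankE // => er; exists T; split=> //.
  have cT := cod_codim_bigcap Tf (fun f _ => hyp_hyperplane f).
  have ceT := cod_codim_bigcap eTf (fun f _ => hyp_hyperplane f).
  rewrite -/(meet T) -/(meet (e |` T)) er in cT ceT.
  have sub : meet (e |` T) `<=` meet T by apply: meet_sub => f; right.
  rewrite (cod_eq (@subspace_meet (e |` T)) (@subspace_meet T) sub ceT cT) U1.
  by move=> z [].
split=> //; exists T; split=> //; rewrite !frame_rankE ?U1 ?setIidr //.
by rewrite finite_setU; split=> //; exact: finite_set1.
Qed.

Lemma edges_above_meet S e : S e -> edges_above (meet S) e.
Proof. by move=> Se z; apply. Qed.

Lemma meet_edges_above S : meet (edges_above (meet S)) = meet S.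
Proof.
apply/seteqP; split=> z; last by move=> Sz e; apply.
by move=> Sz e Se; apply: Sz; exact: edges_above_meet.
Qed.

Lemma closed_edges_above S : closed_set FM (edges_above (meet S)).
Proof.
split=> //; apply/seteqP; split=> e.
  case/closureP => T [_ TS Te] z Sz; apply: Te => f Tf; exact: TS Sz.
move=> Se; apply/closureP; exists [set e]; split=> //; first by move=> f ->.
by rewrite /meet bigcap_set1.
Qed.

Lemma finite_rank_edges_above S : finite_set S -> finite_rank FM (edges_above (meet S)).
Proof.
move=> Sf; have [n _ cn] := cod_bigcap Sf (fun f _ => hyp_hyperplane f).
exists n => F Ff FS; rewrite frame_rankE //.
have [|m [mn cm _]] := cod_sub (@subspace_meet S) (@subspace_meet F) _ cn.
  by move=> z Sz e /FS; apply.
by rewrite (codimE (@subspace_meet F) cm).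
Qed.

(** Take [T] of largest rank among the finite subsets of [F]: adding an edge of [F] cannot raise the
    rank, hence cannot shrink the flat. *)
Lemma finite_rank_meet (F : set A) : finite_rank FM F ->
  exists T, [/\ finite_set T, T `<=` F & meet T = meet F].
Proof.
case=> n Fn.
have [T [Tf TF Tmax]] : exists T, [/\ finite_set T, T `<=` F & forall U,
    finite_set U -> U `<=` F -> (codim (meet U) <= codim (meet T))%N].
  pose Q k := `[< exists2 T, finite_set T /\ T `<=` F & codim (meet T) = k >].
  have exQ : exists k, Q k.
    exists (codim (meet set0)); apply/asboolP; exists set0 => //.
    by split; [exact: finite_set0|exact: sub0set].
  have bQ k : Q k -> (k <= n)%N.
    by move=> /asboolP[T [Tf TF] <-]; rewrite -frame_rankE //; exact: Fn.
  case: (ex_maxnP exQ bQ) => k /asboolP[T [Tf TF] <-] kmax.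
  exists T; split=> // U Uf UF; apply: kmax; apply/asboolP; by exists U.
exists T; split=> //; apply/seteqP; split; last exact: meet_sub.
move=> z Tz e Fe.
have eTf : finite_set (e |` T) by rewrite finite_setU; split=> //; exact: finite_set1.
have cT := cod_codim_bigcap Tf (fun f _ => hyp_hyperplane f).
have ceT := cod_codim_bigcap eTf (fun f _ => hyp_hyperplane f).
have U1 : e |` T `<=` F by move=> f [->|/TF].
have sub : meet (e |` T) `<=` meet T by apply: meet_sub => f; right.
have [m [mn cm me]] := cod_sub (@subspace_meet (e |` T)) (@subspace_meet T) sub ceT.
have mE := codimE (@subspace_meet T) cm.
have eT : meet T = meet (e |` T).
  by apply: me; apply/eqP; rewrite eqn_leq mn -mE; exact: Tmax.
by move: Tz; rewrite eT; apply; left.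
Qed.

Lemma closed_edges_aboveE (F : set A) T : closed_set FM F -> finite_set T ->
  T `<=` F -> meet T = meet F -> edges_above (meet T) = F.
Proof.
move=> [_ cF] Tf TF TE; apply/seteqP; split=> e.
  by move=> Te; rewrite -cF; apply/closureP; exists T.
by move=> Fe z; rewrite TE; apply.
Qed.

Lemma edges_above_inj S T :
  edges_above (meet S) = edges_above (meet T) :> set A -> meet S = meet T.
Proof. by move=> e; rewrite -meet_edges_above e meet_edges_above. Qed.

(** Finite rank gives surjectivity: [finite_rank_meet] replaces a closed set by a finite subset with
    the same flat. *)
Lemma finite_flats_bij : set_bij (finite_intersection_flats A)
  [set F | closed_set FM F /\ finite_rank FM F] (@edges_above P A).
Proof.
split.
- move=> _ [S Sf ->]; split; first exact: closed_edges_above.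
  exact: finite_rank_edges_above.
- move=> t s /set_mem[S _ ->] /set_mem[T _ ->]; exact: edges_above_inj.
- move=> F [cF /finite_rank_meet[T [Tf TF TE]]].
  by exists (meet T); [exists T|exact: closed_edges_aboveE].
Qed.

Lemma finite_nodes_rank (F : set A) : finite_set [set: N] -> finite_rank FM F.
Proof.
move=> Nf; exists (ncard [set: N]) => T Tf _.
by apply: leq_trans (leq_subr _ _) _; apply: subset_ncard.
Qed.

Lemma flats_bij : finite_set [set: N] ->
  set_bij (intersection_flats A) [set F | closed_set FM F] (@edges_above P A).
Proof.
move=> Nf; split.
- by move=> _ [S ->]; exact: closed_edges_above.
- move=> t s /set_mem[S ->] /set_mem[T ->]; exact: edges_above_inj.
- move=> F cF; have [T [Tf TF TE]] := finite_rank_meet (finite_nodes_rank F Nf).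
  by exists (meet T); [exists T|exact: closed_edges_aboveE].
Qed.

Lemma unbalanced_flatP S : S !=set0 -> connected G S -> finite_set (nodes_of G S) ->
  ~ balanced (Omega hat A) S <->
  exists X, meet S = \bigcap_(v in X) node_hyperplane hat v.
Proof.
move=> S0 Sc Xf; have bP := balancedP S0 Sc Xf; split.
  move=> /bP npot; exists (nodes_of G S); rewrite meet_unbalanced //.
  by rewrite -coord_bigcap //; apply: eq_bigcapr => v _; rewrite node_hyperplaneE.
case=> Y YE /bP[q [Sq Xq]].
(* The intersection over an empty [Y] is the whole space, whereas [S] has an edge and its hyperplane
   is proper. *)
have [v Yv] : Y !=set0.
  apply/set0P/eqP => Y0; rewrite Y0 bigcap_set0 in YE.
  case: S0 => e Se; apply: (hyperplane_neqT (hyp_hyperplane e)).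
  apply/seteqP; split=> // z _; have : meet S z by rewrite YE.
  exact.
have SZ : meet S `<=` Z [set v].
  by rewrite YE => z /(_ v Yv); rewrite node_hyperplaneE.
(* A node of [S] contradicts the potential; for any other [v] the flat contains [hat v], which the
   node hyperplane of [v] misses. *)
have [Xv|nXv] := pselect (nodes_of G S v); first by apply: (Xq v Xv); exact: SZ.
by have /SZ/coord_hat := meet_hat nXv; apply.
Qed.

End Arrangement.
End Coordinates.

Theorem theorem2p10 (P : projGeom) (N : Type) (hat : N -> P)
    (hat_inj : injective hat) (hat_basis : point_basis (range hat))
    (A : set (set P)) (A_apical : A `<=` apical_hyperplanes hat) :
  [/\ is_biased_graph (Omega hat A),
      matroid_iso (@hyp P A) (frame_matroid (Omega hat A))
        (arrangement_matroid A),
      set_bij (finite_intersection_flats A)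
        [set F | closed_set (frame_matroid (Omega hat A)) F /\
                 finite_rank (frame_matroid (Omega hat A)) F]
        (@edges_above P A) /\
      (finite_set [set: N] ->
        set_bij (intersection_flats A)
          [set F | closed_set (frame_matroid (Omega hat A)) F]
          (@edges_above P A))
    & forall S : set A, S !=set0 -> connected (Omega hat A) S ->
        finite_set (nodes_of (Omega hat A) S) ->
        (~ balanced (Omega hat A) S <->
         exists X : set N,
           \bigcap_(e in S) hyp e = \bigcap_(v in X) node_hyperplane hat v)].
Proof.
split.
- exact: Omega_biased.
- exact: frame_matroid_iso.
- by split; [exact: finite_flats_bij|exact: flats_bij].
- by move=> S S0 Sc Sf; exact: unbalanced_flatP.
Qed.
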